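(* Let $d\geq 1$, let $f\in L^{\infty }(T^{d})$ with $\Vert f\Vert _{L^{\infty }(T^{d})}\leq 1$, and let $\nu \in \mathbb{Z}^{d}$. Let $E=\{x\in T^{d}:|f(x)|=1\}$ and for $n,k\in \mathbb{Z}$ put \[ b_{n,n-k}=\int_{E}f(x)^{n}e^{-2\pi i(n-k)\nu \cdot x}\,dx . \] Suppose that $\hat{f}(\xi )=0$ for all $\xi $ in a half-space $S$ of lattice points, that $\nu \in -S$, and that $\hat{f}(0)\neq 0$, and put $C=\log \frac{16}{|\hat{f}(0)|^{4}}$. Then for all integers $M\geq 1$, $p\geq 1$ and all $k\in \mathbb{Z}$, \[ \frac{1}{p+1}\sum_{m=M}^{M+p}|b_{m,m-k}|^{2}\leq \frac{C}{\log (p+1)}. \]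
   Context: $T^{d}=\mathbb{R}^{d}/\mathbb{Z}^{d}$ is the $d$-dimensional torus with normalized Lebesgue measure $dx$, and $\hat{f}(\xi )=\int_{T^{d}}f(x)e^{-2\pi i\xi \cdot x}dx$ for $\xi \in \mathbb{Z}^{d}$. A set $S\subset \mathbb{Z}^{d}$ is a half-space of lattice points if (i) $0\notin S$; (ii) for every $\xi \neq 0$ in $\mathbb{Z}^d$, $\xi \in S$ or $-\xi \in S$; (iii) $\xi ,\xi ^{\prime }\in S$ implies $\xi +\xi ^{\prime }\in S$. Here $-S=\{-\xi :\xi \in S\}$. *)

(* Defs.v *)
From HB Require Import structures.
From mathcomp Require Import all_boot all_order all_algebra.
From mathcomp Require Import all_classical all_reals all_analysis.
From mathcomp Require Import complex.

Set Implicit Arguments.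
Unset Strict Implicit.
Unset Printing Implicit Defensive.

Import Order.TTheory GRing.Theory Num.Theory.
Local Open Scope classical_set_scope.
Local Open Scope ring_scope.

(* Lebesgue measure on R restricted to [0,1[  (a fundamental domain of T = R/Z). *)
Definition leb01 (R : realType) : set R -> \bar R :=
  fun A => lebesgue_measure (A `&` `[0%R, 1%R[).

(* The normalized Lebesgue measure on T^d, realized on d-tuples of reals as the
   d-fold product of Lebesgue measure on [0,1[ (built with the library's
   product measure \x and pushed forward along (t, x) |-> t :: x). *)
Fixpoint torus_measure (R : realType) (n : nat) : set (n.-tuple R) -> \bar R :=
  match n with
  | 0 => @dirac _ (0.-tuple R) [tuple] R
  | n'.+1 => pushforward (product_measure1 (@leb01 R) (@torus_measure R n'))
                         (fun p : R * n'.-tuple R => [tuple of p.1 :: p.2])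
  end.

Definition cintegral d (T : measurableType d) (R : realType)
  (mu : set T -> \bar R) (D : set T) (g : T -> R[i]) : R[i] :=
  Complex (fine (\int[mu]_(x in D) (complex.Re (g x))%:E))
    (fine (\int[mu]_(x in D) (complex.Im (g x))%:E)).

Definition expi (R : realType) (t : R) : R[i] := Complex (cos t) (sin t).

Definition dotZR (R : realType) (d : nat) (xi : 'rV[int]_d) (x : d.-tuple R) : R :=
  \sum_(i < d) (xi ord0 i)%:~R * tnth x i.

Definition char (R : realType) (d : nat) (xi : 'rV[int]_d) (x : d.-tuple R) : R[i] :=
  expi (- (2 * pi * dotZR xi x)).

Definition fourier (R : realType) (d : nat) (f : d.-tuple R -> R[i]) (xi : 'rV[int]_d) : R[i] :=
  cintegral (@torus_measure R d) setT (fun x => f x * char xi x).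

Definition is_halfspace (d : nat) (S : set 'rV[int]_d) : Prop :=
  [/\ ~ S 0,
      (forall xi : 'rV[int]_d, xi != 0 -> S xi \/ S (- xi))
    & (forall xi xi' : 'rV[int]_d, S xi -> S xi' -> S (xi + xi'))].

(* Main.v *)
Require Import Defs.
From HB Require Import structures.
From mathcomp Require Import all_boot all_order all_algebra.
From mathcomp Require Import all_classical all_reals all_analysis.
From mathcomp Require Import measurable_realfun complex ring lra.
Set Implicit Arguments.
Unset Strict Implicit.
Unset Printing Implicit Defensive.
Import Order.TTheory GRing.Theory Num.Theory numFieldNormedType.Exports.
Local Open Scope classical_set_scope.
Local Open Scope ring_scope.

Local Notation Re := complex.Re.
Local Notation Im := complex.Im.
Local Notation normc := ComplexField.Normc.normc.

(* The Fourier coefficients b_{m,m-k} are those of the image under g = f e_{-nu} of a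
   complex measure carried by E, where g is unimodular; the square mean of
   b_{m,m-k} over a window of length N is the double integral of a Dirichlet kernel,
   whose modulus at g(y)/g(x) is at most min (1, 2 / (N |g(y) - g(x)|)).  Up to
   constants this is at most log (1 / |g(y) - g(x)|) / log N.  Now
   |g(y) - g(x)| = |f(y) - g(x) e_nu(y)|, and for each fixed x the function
   h = f - g(x) e_nu has its spectrum in the complement of S and mean \hat f(0), so
   the Helson-Lowdenslager form of Jensen's inequality gives
   \int log |h| >= log |\hat f(0)|.

   Jensen's inequality comes from the lower bound
     \int |F|^2 w >= |\int h|^2   for  w = |h|^2 + eps
   over all products F of factors 1 + a chi_xi with xi in S.  The class of functions u
   such that replacing w by w exp (- (u - \int u)) always preserves such a bound is
   stable under sums and bounded almost everywhere limits and contains the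
   harmonics, hence every bounded measurable function; u = log w and F = 1 conclude. *)

(** * Integrals of bounded functions over a probability space *)

(** The bound holds at every point rather than almost everywhere, so the class is closed under
    pointwise operations and its members are integrable for every probability. *)
Definition bmeas d (T : measurableType d) (R : realType) (u : T -> R) : Prop :=
  measurable_fun setT u /\ exists M, forall x, `|u x| <= M.

Section BoundedIntegrals.
Context d (T : measurableType d) (R : realType).
Implicit Types u v : T -> R.

Lemma bmeas_cst (c : R) : bmeas (fun _ : T => c).
Proof. by split; [exact: measurable_cst | exists `|c|]. Qed.

Lemma bmeasD u v : bmeas u -> bmeas v -> bmeas (fun x => u x + v x).
Proof.
move=> [mu [M uM]] [mv [N vN]]; split; first exact: measurable_funD.
by exists (M + N) => x; rewrite (le_trans (ler_normD _ _))// lerD.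
Qed.

Lemma bmeasM u v : bmeas u -> bmeas v -> bmeas (fun x => u x * v x).
Proof.
move=> [mu [M uM]] [mv [N vN]]; split; first exact: measurable_funM.
by exists (M * N) => x; rewrite normrM ler_pM.
Qed.

Lemma bmeasZ (c : R) u : bmeas u -> bmeas (fun x => c * u x).
Proof. by move=> bu; apply: bmeasM => //; exact: bmeas_cst. Qed.

Lemma bmeasN u : bmeas u -> bmeas (fun x => - u x).
Proof.
move=> /(bmeasZ (-1)) h; rewrite (_ : (fun _ => _) = fun x => -1 * u x)//.
by apply/funext => x; rewrite mulN1r.
Qed.

Lemma bmeasB u v : bmeas u -> bmeas v -> bmeas (fun x => u x - v x).
Proof. by move=> bu bv; apply: bmeasD => //; exact: bmeasN. Qed.

Lemma bmeasX u n : bmeas u -> bmeas (fun x => u x ^+ n).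
Proof.
move=> bu; elim: n => [|n IH]; first exact: bmeas_cst.
rewrite (_ : (fun _ => _) = fun x => u x * u x ^+ n); first exact: bmeasM.
by apply/funext => x; rewrite exprS.
Qed.

Lemma bmeas_expR u : bmeas u -> bmeas (fun x => expR (u x)).
Proof.
move=> [mu [M uM]]; split; first by apply: measurableT_comp => //; exact: measurable_expR.
exists (expR M) => x; rewrite ger0_norm ?expR_ge0// ler_expR.
by rewrite (le_trans _ (uM x))// ler_norm.
Qed.

Lemma bmeas_indic (A : set T) : measurable A -> bmeas (\1_A : T -> R).
Proof.
move=> mA; split; first exact: measurable_indic.
by exists 1 => x; rewrite indicE; case: (_ \in _); rewrite ?normr1 ?normr0.
Qed.

Lemma measurable_ltr u v : measurable_fun setT u -> measurable_fun setT v ->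
  measurable [set x | u x < v x].
Proof.
move=> mu mv; rewrite -[X in measurable X]setTI.
by have /(_ measurableT [set true]) := measurable_fun_ltr mu mv; exact.
Qed.

Lemma measurable_ler u v : measurable_fun setT u -> measurable_fun setT v ->
  measurable [set x | u x <= v x].
Proof.
move=> mu mv; rewrite -[X in measurable X]setTI.
by have /(_ measurableT [set true]) := measurable_fun_ler mu mv; exact.
Qed.

Variable P : probability T R.

Lemma bmeas_integrable u : bmeas u -> P.-integrable setT (EFin \o u).
Proof.
move=> [mu [M uM]]; apply: measurable_bounded_integrable => //.
  by rewrite (le_lt_trans (probability_le1 P measurableT))// ltry.
exists M; split; first by rewrite num_real.
by move=> N MN x _ /=; rewrite (le_trans (uM x))// ltW.
Qed.

Lemma Rint_cst (c : R) : \int[P]_x c = c.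
Proof.
rewrite Rintegral_cst//; move: (@probability_setT _ _ _ P) => /= ->.
by rewrite mulr1.
Qed.

Lemma RintD u v : bmeas u -> bmeas v ->
  \int[P]_x (u x + v x) = \int[P]_x u x + \int[P]_x v x.
Proof. by move=> bu bv; apply: RintegralD => //; exact: bmeas_integrable. Qed.

Lemma RintB u v : bmeas u -> bmeas v ->
  \int[P]_x (u x - v x) = \int[P]_x u x - \int[P]_x v x.
Proof. by move=> bu bv; apply: RintegralB => //; exact: bmeas_integrable. Qed.

Lemma RintZ (c : R) u : bmeas u -> \int[P]_x (c * u x) = c * \int[P]_x u x.
Proof. by move=> bu; apply: RintegralZl => //; exact: bmeas_integrable. Qed.

Lemma le_Rint u v : bmeas u -> bmeas v -> (forall x, u x <= v x) ->
  \int[P]_x u x <= \int[P]_x v x.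
Proof.
by move=> bu bv uv; apply: le_Rintegral => //; exact: bmeas_integrable.
Qed.

Lemma ae_eq_Rint u v : measurable_fun setT u -> measurable_fun setT v ->
  {ae P, forall x, u x = v x} ->
  \int[P]_x u x = \int[P]_x v x.
Proof.
move=> mu mv uv; rewrite /Rintegral; congr fine.
apply: ae_eq_integral => //; [exact/measurable_EFinP|exact/measurable_EFinP|].
by apply: filterS uv => x /= -> .
Qed.

(** Dominated convergence with the constant [M] as dominating function, integrable because the total
    mass is finite. *)
Lemma cvg_Rint (u_ : (T -> R)^nat) u M :
  (forall n, measurable_fun setT (u_ n)) -> bmeas u ->
  (forall n x, `|u_ n x| <= M) ->
  {ae P, forall x, u_ ^~ x @ \oo --> u x} ->
  \int[P]_x u_ n x @[n --> \oo] --> \int[P]_x u x.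
Proof.
move=> mu_ bu u_M cu.
have [mu _] := bu.
have [] := @dominated_convergence _ _ _ P setT measurableT (fun n => EFin \o u_ n)
  (EFin \o u) (fun _ => M%:E).
- by move=> n; exact/measurable_EFinP.
- exact/measurable_EFinP.
- by apply: filterS cu => x /= cu _; by apply: cvg_EFin => //; exact: nearW.
- exact: bmeas_integrable (bmeas_cst M).
- by apply/aeW => x n _ /=; rewrite lee_fin.
move=> _ _ h.
rewrite /Rintegral; apply: fine_cvg.
rewrite fineK; first exact: h.
by apply: integrable_fin_num => //; exact: bmeas_integrable.
Unshelve. all: by end_near.
Qed.

End BoundedIntegrals.

(** * Moduli and real and imaginary parts of complex numbers *)

Section ComplexNumbers.
Context (R : realType).
Implicit Types z w : R[i].

(** A polynomial in the two parts, hence open to [ring] and to the measurability rules, unlike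
    [normc], which carries a square root. *)
Definition sqnormc z : R := Re z ^+ 2 + Im z ^+ 2.

Lemma RecD z w : Re (z + w) = Re z + Re w. Proof. by case: z; case: w. Qed.
Lemma ImcD z w : Im (z + w) = Im z + Im w. Proof. by case: z; case: w. Qed.
Lemma RecM z w : Re (z * w) = Re z * Re w - Im z * Im w.
Proof. by case: z; case: w. Qed.
Lemma ImcM z w : Im (z * w) = Re z * Im w + Im z * Re w.
Proof. by case: z; case: w. Qed.
Lemma RecN z : Re (- z) = - Re z. Proof. by case: z. Qed.
Lemma ImcN z : Im (- z) = - Im z. Proof. by case: z. Qed.

Lemma complex_ext z w : Re z = Re w -> Im z = Im w -> z = w.
Proof. by case: z => a b; case: w => c e /= -> ->. Qed.

Definition ReImE := (RecD, ImcD, RecM, ImcM, RecN, ImcN).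

Lemma sqnormc_ge0 z : 0 <= sqnormc z.
Proof. by rewrite addr_ge0// sqr_ge0. Qed.

Lemma normcEsqrt z : normc z = Num.sqrt (sqnormc z).
Proof. by case: z. Qed.

Lemma normc_ge0 z : 0 <= normc z.
Proof. by rewrite normcEsqrt sqrtr_ge0. Qed.

Lemma normcEsqr z : normc z ^+ 2 = sqnormc z.
Proof. by rewrite normcEsqrt sqr_sqrtr// sqnormc_ge0. Qed.

Lemma sqnormcM z w : sqnormc (z * w) = sqnormc z * sqnormc w.
Proof. by rewrite /sqnormc !ReImE; ring. Qed.

Lemma sqnormcX z n : sqnormc (z ^+ n) = sqnormc z ^+ n.
Proof.
elim: n => [|n IH]; first by rewrite /sqnormc /= expr0n addr0 expr1n.
by rewrite !exprS sqnormcM IH.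
Qed.

Lemma normcX z n : normc (z ^+ n) = normc z ^+ n.
Proof.
elim: n => [|n IH]; first exact: ComplexField.Normc.normc1.
by rewrite !exprS ComplexField.Normc.normcM IH.
Qed.

Lemma normr_Re_le z : `|Re z| <= normc z.
Proof. by rewrite -sqrtr_sqr normcEsqrt ler_wsqrtr// lerDl sqr_ge0. Qed.

Lemma normr_Im_le z : `|Im z| <= normc z.
Proof. by rewrite -sqrtr_sqr normcEsqrt ler_wsqrtr// lerDr sqr_ge0. Qed.

Lemma ler_normcD z w : normc (z + w) <= normc z + normc w.
Proof. exact: le_normcD. Qed.

Lemma expiD (s t : R) : expi (s + t) = expi s * expi t.
Proof.
by apply: complex_ext; rewrite !ReImE/= ?cosD ?sinD//; rewrite addrC mulrC.
Qed.

Lemma sqnormc_expi (t : R) : sqnormc (expi t) = 1.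
Proof. exact: cos2Dsin2. Qed.

(** Cauchy-Schwarz in the plane, by Lagrange's identity: the defect between the two squares is the
    square of the determinant. *)
Lemma dotReIm_le z w : Re z * Re w + Im z * Im w <= normc z * normc w.
Proof.
rewrite -ComplexField.Normc.normcM normcEsqrt.
have h : `|Re z * Re w + Im z * Im w| <= Num.sqrt (sqnormc (z * w)).
  rewrite -sqrtr_sqr ler_wsqrtr// sqnormcM /sqnormc -subr_ge0.
  by rewrite (_ : _ - _ = (Re z * Im w - Im z * Re w) ^+ 2) ?sqr_ge0//; ring.
exact: le_trans (ler_norm _) h.
Qed.

End ComplexNumbers.

(** * Integrals of bounded complex functions *)

Definition cmeas d (T : measurableType d) (R : realType) (h : T -> R[i]) : Prop :=
  bmeas (fun x => Re (h x)) /\ bmeas (fun x => Im (h x)).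

Section ComplexIntegrals.
Context d (T : measurableType d) (R : realType).
Implicit Types h k : T -> R[i].

Lemma cmeas_cst (c : R[i]) : cmeas (fun _ : T => c).
Proof. by split; exact: bmeas_cst. Qed.

Lemma cmeasD h k : cmeas h -> cmeas k -> cmeas (fun x => h x + k x).
Proof.
move=> [h1 h2] [k1 k2]; split.
  under eq_fun do rewrite RecD; exact: bmeasD.
under eq_fun do rewrite ImcD; exact: bmeasD.
Qed.

Lemma cmeasM h k : cmeas h -> cmeas k -> cmeas (fun x => h x * k x).
Proof.
move=> [h1 h2] [k1 k2]; split.
  under eq_fun do rewrite RecM; apply: bmeasB; exact: bmeasM.
under eq_fun do rewrite ImcM; apply: bmeasD; exact: bmeasM.
Qed.

Lemma cmeasZ (c : R[i]) h : cmeas h -> cmeas (fun x => c * h x).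
Proof. by move=> ch; apply: cmeasM => //; exact: cmeas_cst. Qed.

Lemma cmeasX h n : cmeas h -> cmeas (fun x => h x ^+ n).
Proof.
move=> ch; elim: n => [|n IH]; first exact: cmeas_cst.
under eq_fun do rewrite exprS; exact: cmeasM.
Qed.

Lemma cmeas_sum (r : seq nat) (F : nat -> T -> R[i]) :
  (forall i, cmeas (F i)) -> cmeas (fun x => \sum_(i <- r) F i x).
Proof.
move=> cF; elim: r => [|i r IH].
  by under eq_fun do rewrite big_nil; exact: cmeas_cst.
by under eq_fun do rewrite big_cons; exact: cmeasD.
Qed.

Lemma bmeas_sqnormc h : cmeas h -> bmeas (fun x => sqnormc (h x)).
Proof. by move=> [h1 h2]; apply: bmeasD; exact: bmeasX. Qed.

Variable P : probability T R.
Local Notation J := (cintegral P setT).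

Lemma cintegralE h : J h = Complex (\int[P]_x Re (h x)) (\int[P]_x Im (h x)).
Proof. by []. Qed.

Lemma cint_cst (c : R[i]) : J (fun=> c) = c.
Proof. by rewrite cintegralE !Rint_cst; case: c. Qed.

Lemma cintD h k : cmeas h -> cmeas k -> J (fun x => h x + k x) = J h + J k.
Proof.
move=> [h1 h2] [k1 k2]; rewrite !cintegralE; apply: complex_ext => /=.
  by under eq_Rintegral do rewrite RecD; exact: RintD.
by under eq_Rintegral do rewrite ImcD; exact: RintD.
Qed.

Lemma cintZ (c : R[i]) h : cmeas h -> J (fun x => c * h x) = c * J h.
Proof.
move=> [h1 h2]; rewrite !cintegralE; apply: complex_ext => /=.
  under eq_Rintegral do rewrite RecM.
  by rewrite RintB ?RintZ ?RecM//; exact: bmeasZ.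
under eq_Rintegral do rewrite ImcM.
by rewrite RintD ?RintZ ?ImcM//; exact: bmeasZ.
Qed.

Lemma sqnormc_cint_le h : cmeas h -> sqnormc (J h) <= \int[P]_x sqnormc (h x).
Proof.
move=> [h1 h2]; have hh := bmeas_sqnormc (conj h1 h2).
suff sqr_int u : bmeas u -> (\int[P]_x u x) ^+ 2 <= \int[P]_x (u x ^+ 2).
  rewrite /sqnormc RintD; [|exact: bmeasX..].
  by rewrite lerD// sqr_int.
move=> bu; set a := \int[P]_x u x.
(* Nonnegativity of the variance: the integrand is [(u x - a) ^+ 2]. *)
have : 0 <= \int[P]_x (u x ^+ 2 - (2 * a * u x - a ^+ 2)).
  apply: Rintegral_ge0 => x _.
  by rewrite (_ : _ - _ = (u x - a) ^+ 2) ?sqr_ge0//; ring.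
have bau : bmeas (fun x => 2 * a * u x) by exact: bmeasZ.
rewrite RintB; [|exact: bmeasX|apply: bmeasB => //; exact: bmeas_cst].
rewrite RintB//; last exact: bmeas_cst.
rewrite RintZ// Rint_cst -/a; nra.
Qed.

(** Testing against the direction of the integral [z] itself: |z|^2 is the integral of the real part
    of conj(z) h, which is at most |z| v pointwise, and one factor |z| cancels. *)
Lemma normc_cint_le h v : cmeas h -> bmeas v ->
  (forall x, normc (h x) <= v x) -> normc (J h) <= \int[P]_x v x.
Proof.
move=> ch bv hv; set z := J h; have [h1 h2] := ch.
have v0 : 0 <= \int[P]_x v x.
  by apply: Rintegral_ge0 => x _; exact: le_trans (normc_ge0 _) (hv x).
have [z0|z0] := leP (normc z) 0; first exact: le_trans z0 v0.
rewrite -(ler_pM2l z0) -expr2 normcEsqr.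
have -> : sqnormc z = \int[P]_x (Re z * Re (h x) + Im z * Im (h x)).
  rewrite RintD; [|exact: bmeasZ..].
  by rewrite !RintZ.
rewrite -RintZ//; apply: le_Rint; [by apply: bmeasD; exact: bmeasZ|exact: bmeasZ|].
by move=> x; rewrite (le_trans (dotReIm_le _ _))// ler_wpM2l// normc_ge0.
Qed.

Lemma cint_sum (r : seq nat) (F : nat -> T -> R[i]) :
  (forall i, cmeas (F i)) ->
  J (fun x => \sum_(i <- r) F i x) = \sum_(i <- r) J (F i).
Proof.
move=> cF; elim: r => [|i r IH].
  by under eq_fun do rewrite big_nil; rewrite big_nil cint_cst.
rewrite big_cons -IH -cintD//; last exact: cmeas_sum.
by congr (J _); apply/funext => x; rewrite big_cons.
Qed.

Lemma normc_cint_le_cst h (K : R) : cmeas h -> (forall x, normc (h x) <= K) ->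
  normc (J h) <= K.
Proof.
move=> ch hK; rewrite -[leRHS](Rint_cst P).
by apply: normc_cint_le => //; exact: bmeas_cst.
Qed.

(** Only measurability is asked for, so that the lemma applies to the [f] of the theorem, which is
    bounded merely almost everywhere. *)
Lemma ae_eq_cint h k :
  measurable_fun setT (fun x => Re (h x)) -> measurable_fun setT (fun x => Im (h x)) ->
  measurable_fun setT (fun x => Re (k x)) -> measurable_fun setT (fun x => Im (k x)) ->
  {ae P, forall x, h x = k x} -> J h = J k.
Proof.
move=> h1 h2 k1 k2 hk; rewrite !cintegralE; congr Complex.
  by apply: ae_eq_Rint => //; apply: filterS hk => x /= ->.
by apply: ae_eq_Rint => //; apply: filterS hk => x /= ->.
Qed.

End ComplexIntegrals.

(** * Szego-type lower bounds and tilting *)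

Section Characters.
Context (R : realType) (d : nat).
Implicit Types (xi eta : 'rV[int]_d) (x : d.-tuple R).

Lemma dotZRD xi eta x : dotZR (xi + eta) x = dotZR xi x + dotZR eta x.
Proof.
by rewrite /dotZR -big_split/=; apply: eq_bigr => i _; rewrite mxE rmorphD/= mulrDl.
Qed.

Lemma dotZR0 x : dotZR 0 x = 0.
Proof. by rewrite /dotZR big1// => i _; rewrite mxE mul0r. Qed.

Lemma dotZRN xi x : dotZR (- xi) x = - dotZR xi x.
Proof. by apply/eqP; rewrite -addr_eq0 -dotZRD addNr dotZR0. Qed.

Lemma charD xi eta x : char (xi + eta) x = char xi x * char eta x.
Proof. by rewrite /char -expiD dotZRD mulrDr opprD. Qed.

Lemma char0 x : char 0 x = 1.
Proof.
by rewrite /char dotZR0 mulr0 oppr0; apply: complex_ext; rewrite /= ?cos0 ?sin0.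
Qed.

Lemma Re_charN xi x : Re (char (- xi) x) = Re (char xi x).
Proof. by rewrite /char dotZRN mulrN opprK /= cosN. Qed.

Lemma Im_charN xi x : Im (char (- xi) x) = - Im (char xi x).
Proof. by rewrite /char dotZRN mulrN opprK /= sinN opprK. Qed.

Lemma charX xi n x : char (xi *+ n) x = char xi x ^+ n.
Proof.
elim: n => [|n IH]; first by rewrite mulr0n char0.
by rewrite mulrS charD IH exprS.
Qed.

Lemma sqnormc_char xi x : sqnormc (char xi x) = 1.
Proof. exact: sqnormc_expi. Qed.

Lemma normc_char xi x : normc (char xi x) = 1.
Proof. by rewrite normcEsqrt sqnormc_char sqrtr1. Qed.

Lemma cmeas_char xi : cmeas (fun x : d.-tuple R => char xi x).
Proof.
have m : measurable_fun setT (fun x : d.-tuple R => - (2 * pi * dotZR xi x)).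
  apply: measurable_funN; apply: measurable_funM; first exact: measurable_cst.
  apply: measurable_sum => i; apply: measurable_funM; first exact: measurable_cst.
  exact: measurable_tnth.
split; split.
- apply: (measurableT_comp _ m); apply: continuous_measurable_fun.
  exact: continuous_cos.
- by exists 1 => x; rewrite -(normc_char xi x) normr_Re_le.
- apply: (measurableT_comp _ m); apply: continuous_measurable_fun.
  exact: continuous_sin.
- by exists 1 => x; rewrite -(normc_char xi x) normr_Im_le.
Qed.

End Characters.

Lemma halfspace_neq0 (d : nat) (S : set 'rV[int]_d) xi :
  is_halfspace S -> S xi -> xi != 0.
Proof. by move=> [S0 _ _] Sxi; apply/eqP => xi0; apply: S0; rewrite -xi0. Qed.

(** Expanded, such a product is 1 plus a combination of characters [char xi] with [xi] in [S],
    because [S] is closed under addition. The product form makes it immediate to multiply by further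
    factors. *)
Inductive analytic (R : realType) (d : nat) (S : set 'rV[int]_d) :
    (d.-tuple R -> R[i]) -> Prop :=
  | analytic1 : analytic S (fun=> 1)
  | analyticM (a : R[i]) xi F : S xi -> analytic S F ->
      analytic S (fun x => (1 + a * char xi x) * F x).

Section Szego.
Context (R : realType) (d : nat) (P : probability (d.-tuple R) R).
Variable S : set 'rV[int]_d.
Hypothesis halfS : is_halfspace S.
Hypothesis int_char : forall xi, xi != 0 -> cintegral P setT (char xi) = 0.
Implicit Types (u v w : d.-tuple R -> R) (F h : d.-tuple R -> R[i]).

Local Notation J := (cintegral P setT).

Lemma analytic_cmeas F : analytic S F -> cmeas F.
Proof.
elim => [|a xi {}F _ _ cF]; first exact: cmeas_cst.
apply: cmeasM => //; apply: cmeasD; first exact: cmeas_cst.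
by apply: cmeasZ; exact: cmeas_char.
Qed.

Lemma analyticX F (a : R[i]) xi n : S xi -> analytic S F ->
  analytic S (fun x => (1 + a * char xi x) ^+ n * F x).
Proof.
move=> Sxi aF; elim: n => [|n IH]; first by under eq_fun do rewrite expr0 mul1r.
under eq_fun do rewrite exprS -mulrA; exact: analyticM.
Qed.

(** [h] is orthogonal to every term of the expansion of [F] except the constant 1. The induction
    absorbs the outer factor into [h]; the new [h] still annihilates [S] since [S] is stable under
    sums. *)
Lemma cint_analytic h F : cmeas h -> analytic S F ->
  (forall xi, S xi -> J (fun x => h x * char xi x) = 0) ->
  J (fun x => h x * F x) = J h.
Proof.
move=> + aF; elim: aF h => [|a xi {}F Sxi aF IH] h ch h0.
  by congr (J _); apply/funext => x; rewrite mulr1.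
have chx eta : cmeas (fun x => h x * char eta x).
  by apply: cmeasM => //; exact: cmeas_char.
under eq_fun do rewrite mulrA.
rewrite IH.
- under eq_fun do rewrite mulrDr mulr1 mulrCA.
  by rewrite cintD// ?cintZ// ?h0// ?mulr0 ?addr0//; exact: cmeasZ.
- apply: cmeasM => //; apply: cmeasD; first exact: cmeas_cst.
  by apply: cmeasZ; exact: cmeas_char.
move=> eta Seta.
have -> : (fun x => h x * (1 + a * char xi x) * char eta x) =
  (fun x => h x * char eta x + a * (h x * char (xi + eta) x)).
  by apply/funext => x; rewrite charD; ring.
rewrite cintD// ?cintZ// ?h0// ?mulr0 ?addr0//; last exact: cmeasZ.
by case: halfS => _ _; apply.
Qed.

(** [c] is a lower bound in Szego's extremal problem for the weight [w]. *)
Definition szego w (c : R) := forall F, analytic S F ->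
  c <= \int[P]_x (sqnormc (F x) * w x).

(** Subtracting the mean of [u] leaves the integral of log w unchanged, so the same [c] can survive
    the tilt. Quantifying over all weights lets tilts be composed. *)
Definition tilt_stable u := forall w c, bmeas w -> (forall x, 0 <= w x) ->
  szego w c -> szego (fun x => w x * expR (- (u x - \int[P]_x u x))) c.

(** The integral of |h F|^2 is at least the squared modulus of the integral of h F, which equals
    that of h. The term [e] will keep the weight away from zero when its logarithm is taken. *)
Lemma szego_sqnormc h (e : R) : cmeas h -> 0 <= e ->
  (forall xi, S xi -> J (fun x => h x * char xi x) = 0) ->
  szego (fun x => sqnormc (h x) + e) (sqnormc (J h)).
Proof.
move=> ch e0 h0 F aF; have cF := analytic_cmeas aF.
rewrite -(cint_analytic ch aF h0).
apply: le_trans (sqnormc_cint_le P (cmeasM ch cF)) _.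
apply: le_Rint.
- by apply: bmeas_sqnormc; exact: cmeasM.
- apply: bmeasM; first exact: bmeas_sqnormc.
  by apply: bmeasD; [exact: bmeas_sqnormc|exact: bmeas_cst].
- by move=> x; rewrite sqnormcM mulrC ler_wpM2l ?sqnormc_ge0// lerDl.
Qed.

Let bmeas_tilt u : bmeas u -> bmeas (fun x => expR (- (u x - \int[P]_x u x))).
Proof.
by move=> bu; apply: bmeas_expR; apply: bmeasN; apply: bmeasB => //; exact: bmeas_cst.
Qed.

(** Tilting by [u] and then by [v] is tilting by the sum. *)
Lemma tilt_stableD u v : bmeas u -> bmeas v ->
  tilt_stable u -> tilt_stable v -> tilt_stable (fun x => u x + v x).
Proof.
move=> bu bv su sv w c bw w0 /(su _ _ bw w0) /sv h.
have {}h := h (bmeasM bw (bmeas_tilt bu)) (fun x => mulr_ge0 (w0 x) (expR_ge0 _)).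
rewrite (_ : (fun _ => _) = (fun x => w x * expR (- (u x - \int[P]_x u x)) *
  expR (- (v x - \int[P]_x v x))))//.
apply/funext => x; rewrite RintD// -mulrA -expRD; congr (_ * expR _); ring.
Qed.

(** Dominated convergence is used twice: for the means of [u_ n], then for the tilted integrals,
    whose common lower bound passes to the limit. *)
Lemma tilt_stable_lim (u_ : (d.-tuple R -> R)^nat) u (M : R) : bmeas u ->
  (forall n, measurable_fun setT (u_ n)) -> (forall n x, `|u_ n x| <= M) ->
  {ae P, forall x, u_ ^~ x @ \oo --> u x} ->
  (forall n, tilt_stable (u_ n)) -> tilt_stable u.
Proof.
move=> bu mu_ u_M cu su w c bw w0 sw F aF.
have bsF := bmeas_sqnormc (analytic_cmeas aF).
have bu_ n : bmeas (u_ n) by split => //; exists M.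
have cI := cvg_Rint mu_ bu u_M cu.
have le_I n : `|\int[P]_x u_ n x| <= M.
  rewrite ler_norml; apply/andP; split.
    rewrite -(Rint_cst P (- M)); apply: le_Rint => //; first exact: bmeas_cst.
    by move=> x; have := u_M n x; rewrite ler_norml => /andP[].
  rewrite -[leRHS](Rint_cst P); apply: le_Rint => //; first exact: bmeas_cst.
  by move=> x; have := u_M n x; rewrite ler_norml => /andP[].
have [_ [A FA]] := bsF; have [_ [B wB]] := bw.
pose g n x := sqnormc (F x) * (w x * expR (- (u_ n x - \int[P]_x u_ n x))).
have bg n : bmeas (g n).
  by apply: bmeasM => //; apply: bmeasM => //; exact: bmeas_tilt.
have cg : \int[P]_x g n x @[n --> \oo] --> \int[P]_x (sqnormc (F x) *
    (w x * expR (- (u x - \int[P]_x u x)))).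
  (* [A] bounds |F|^2, [B] bounds [w], and both [u_ n] and its mean are at most [M] in absolute
     value. *)
  apply: (@cvg_Rint _ _ _ _ _ _ (A * (B * expR (M + M)))).
  - by move=> n; case: (bg n).
  - by apply: bmeasM => //; apply: bmeasM => //; exact: bmeas_tilt.
  - move=> n x; rewrite /g !normrM ler_pM ?mulr_ge0// ler_pM//.
    rewrite ger0_norm ?expR_ge0// ler_expR (le_trans (ler_norm _))// normrN.
    by rewrite (le_trans (ler_normB _ _))// lerD.
  - apply: filterS cu => x cx; apply: cvgMl_tmp; apply: cvgMl_tmp.
    apply: continuous_cvg; first exact: continuous_expR.
    by apply: cvgN; apply: cvgB.
rewrite -(cvg_lim _ cg)//; apply: limr_ge.
  by apply/cvg_ex; eexists; exact: cg.
by apply: nearW => n; exact: su.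
Qed.

Lemma tilt_stable_cst (a : R) : tilt_stable (fun=> a).
Proof.
move=> w c bw w0; rewrite (_ : (fun _ => _ * expR _) = w)//.
by apply/funext => x; rewrite Rint_cst subrr oppr0 expR0 mulr1.
Qed.

Let RintRe_char (a : R[i]) xi : xi != 0 -> \int[P]_x Re (a * char xi x) = 0.
Proof.
move=> xi0; have : J (fun x => a * char xi x) = 0.
  by rewrite cintZ; [rewrite int_char// mulr0 | exact: cmeas_char].
by rewrite cintegralE => -[].
Qed.

(* [|1 - b chi / n|^(2n)] is the square modulus of an analytic product and is at
   most [exp (- Re (2 b chi) + |b|^2 / n)]. *)
Lemma tilt_stable_analytic (a : R[i]) xi : S xi ->
  tilt_stable (fun x => Re (a * char xi x)).
Proof.
move=> Sxi w c bw w0 sw F aF; rewrite RintRe_char ?(halfspace_neq0 halfS Sxi)//.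
have bsF := bmeas_sqnormc (analytic_cmeas aF).
have br : bmeas (fun x => Re (a * char xi x)).
  by have [] := cmeasZ a (cmeas_char R xi).
set X := \int[P]_x _.
have le_c n : c <= expR (sqnormc (a / 2) * n.+1%:R^-1) * X.
  (* With power [n.+1], the first-order term of |1 + b chi|^2 is - t Re(a chi), since [b] carries
     half of [a]; the powers then approximate the tilt. *)
  pose t : R := n.+1%:R^-1; pose b : R[i] := - (a / 2 * Complex t 0).
  apply: le_trans (sw _ (analyticX b n.+1 Sxi aF)) _.
  rewrite -RintZ; last first.
    apply: bmeasM => //; apply: bmeasM => //; apply: bmeas_expR; apply: bmeasN.
    by apply: bmeasB => //; exact: bmeas_cst.
  apply: le_Rint.
  - by apply: bmeasM => //; apply: bmeas_sqnormc; exact/analytic_cmeas/analyticX.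
  - apply: bmeasZ; apply: bmeasM => //; apply: bmeasM => //.
    by apply: bmeas_expR; apply: bmeasN; apply: bmeasB => //; exact: bmeas_cst.
  move=> x; rewrite sqnormcM sqnormcX subr0.
  rewrite [leRHS](_ : _ = (expR (sqnormc (a / 2) * t) * expR (- Re (a * char xi x)))
    * (sqnormc (F x) * w x)); last by ring.
  rewrite -mulrA ler_wpM2r ?mulr_ge0 ?sqnormc_ge0// -expRD.
  have -> : sqnormc (a / 2) * t - Re (a * char xi x) =
      n.+1%:R * (sqnormc (a / 2) * t ^+ 2 - t * Re (a * char xi x)).
    rewrite [RHS](_ : _ = n.+1%:R * t * (sqnormc (a / 2) * t - Re (a * char xi x))).
      by rewrite divff ?pnatr_eq0// mul1r.
    ring.
  rewrite expRM_natl lerXn2r// ?nnegrE ?sqnormc_ge0 ?expR_ge0//.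
  (* |1 + b chi|^2 is exactly 1 plus the exponent, so 1 + y <= exp y is enough. *)
  apply: le_trans (expR_ge1Dx _); rewrite le_eqVlt; apply/orP; left; apply/eqP.
  have -> : Re (a * char xi x) = Re (a / 2 * char xi x) + Re (a / 2 * char xi x).
    by rewrite -RecD -mulrDl -splitr.
  rewrite -[sqnormc (a / 2)]mulr1 -[X in _ * X * _](sqnormc_char xi x) /b /sqnormc.
  move: (a / 2) (char xi x) (t) => q z s; rewrite !ReImE /=; ring.
have : expR (sqnormc (a / 2) * n.+1%:R^-1) * X @[n --> \oo] --> X.
  rewrite -[X in _ --> X]mul1r; apply: cvgMr_tmp; rewrite -[X in _ --> X]expR0.
  apply: continuous_cvg; first exact: continuous_expR.
  rewrite -[X in _ --> X](mulr0 (sqnormc (a / 2))); apply: cvgMl_tmp.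
  exact: (@cvg_harmonic R).
move=> cX; rewrite -(cvg_lim _ cX)//; apply: limr_ge.
  by apply/cvg_ex; eexists; exact: cX.
exact: nearW.
Qed.

End Szego.

(** * Bounded limits of trigonometric polynomials *)

Lemma bernoulli_ineq (R : realType) (x : R) n : -1 <= x -> 1 + n%:R * x <= (1 + x) ^+ n.
Proof.
move=> x1; elim: n => [|n IH]; first by rewrite mul0r addr0 expr0.
have x0 : 0 <= 1 + x by lra.
rewrite exprS; apply: le_trans (ler_wpM2l x0 IH).
rewrite -natr1 -subr_ge0.
rewrite (_ : _ - _ = n%:R * x ^+ 2); last by ring.
by rewrite mulr_ge0 ?sqr_ge0.
Qed.

(** * Polynomials converging to a step function *)

Section PolynomialStep.
Context (R : realType).
Implicit Types z : R.

(** On [0,1] these polynomials converge to the indicator of z < 1/2. The factor [n] in the exponent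
    forces the limit 0 at z = 1/2 as well, where the exponent [2 ^ n] alone would give 1/e. *)
Definition poly_step n z : R := (1 - z ^+ n) ^+ (n * 2 ^ n)%N.

Lemma poly_step_itv n z : 0 <= z <= 1 -> 0 <= poly_step n z <= 1.
Proof.
move=> /andP[z0 z1]; have zn0 : 0 <= z ^+ n by rewrite exprn_ge0.
have zn1 : z ^+ n <= 1 by rewrite exprn_ile1.
by rewrite /poly_step exprn_ge0 ?exprn_ile1//=; lra.
Qed.

(** With s the square root of z, Bernoulli's inequality for 1/s bounds n s^n, and the remaining
    factor s^n tends to 0. *)
Lemma cvg_natrX z : 0 <= z < 1 -> n%:R * z ^+ n @[n --> \oo] --> (0 : R).
Proof.
move=> /andP[z0 z1]; have [->|zn0] := eqVneq z 0.
  apply: cvg_near_cst; near=> n; rewrite expr0n.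
  have n0 : (0 < n)%N by near: n; exists 1%N.
  by rewrite eqn0Ngt n0 mulr0.
pose s := Num.sqrt z.
have s0 : 0 < s by rewrite sqrtr_gt0 lt_def zn0.
have s1 : s < 1 by rewrite -(sqrtr1 R) ltr_sqrt.
have si1 : 0 < s^-1 - 1 by rewrite subr_gt0 invf_gt1.
have le_n n : n%:R * s ^+ n <= (s^-1 - 1)^-1.
  rewrite -[leRHS]mul1r ler_pdivlMr// mulrAC.
  apply: le_trans (_ : (s^-1) ^+ n * s ^+ n <= 1); last first.
    by rewrite -exprMn mulVf ?expr1n// gt_eqF.
  rewrite ler_wpM2r ?exprn_ge0 ?(ltW s0)//.
  have := @bernoulli_ineq R (s^-1 - 1) n; rewrite addrCA subrr addr0; lra.
apply: (@squeeze_cvgr _ _ _ _ (fun=> 0) (fun n => (s^-1 - 1)^-1 * s ^+ n)).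
- apply: nearW => n; rewrite mulr_ge0 ?exprn_ge0//=.
  rewrite -(sqr_sqrtr z0) -/s expr2 exprMn mulrA ler_wpM2r ?exprn_ge0// ltW//.
- exact: cvg_cst.
- rewrite -[X in _ --> X](mulr0 (s^-1 - 1)^-1); apply: cvgMl_tmp.
  by apply: cvg_expr; rewrite ger0_norm// ltW.
Unshelve. all: by end_near.
Qed.

(** Below 1/2, Bernoulli gives the lower bound 1 - n (2z)^n. From 1/2 on, multiplying by the same
    power of 1 + z^n gives at most 1, while that power is at least n + 1; so the value is at most
    1/(n+1). *)
Lemma cvg_poly_step z : 0 <= z <= 1 ->
  poly_step n z @[n --> \oo] --> ((z < 2^-1)%R%:R : R).
Proof.
move=> z01; have /andP[z0 z1] := z01.
have zn n : 0 <= z ^+ n <= 1 by rewrite exprn_ge0 ?exprn_ile1.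
have natX n : (n * 2 ^ n)%:R * z ^+ n = n%:R * (2 * z) ^+ n :> R.
  by rewrite natrM natrX exprMn mulrA.
have [z2|z2] := ltP z 2^-1.
  apply: (@squeeze_cvgr _ _ _ _ (fun n => 1 - n%:R * (2 * z) ^+ n) (fun=> 1)).
  - apply: nearW => n; have /andP[_ ->] := poly_step_itv n z01.
    rewrite andbT -natX /poly_step.
    have /andP[a0 a1] := zn n.
    by rewrite -mulrN; apply: bernoulli_ineq; lra.
  - rewrite -[X in _ --> X]subr0; apply: cvgB; first exact: cvg_cst.
    by apply: cvg_natrX; lra.
  - exact: cvg_cst.
apply: (@squeeze_cvgr _ _ _ _ (fun=> 0) (@harmonic R)).
- apply: nearW => n /=; have /andP[-> _] := poly_step_itv n z01 => /=.
  have /andP[a0 a1] := zn n.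
  rewrite -[leRHS]mul1r ler_pdivlMr//.
  have h : n.+1%:R <= (1 + z ^+ n) ^+ (n * 2 ^ n) :> R.
    apply: le_trans (bernoulli_ineq _ _); last by lra.
    rewrite natX -natr1 addrC lerD2l -[leLHS]mulr1 ler_wpM2l//.
    by rewrite exprn_ege1//; lra.
  apply: le_trans (ler_wpM2l _ h) _.
    by have /andP[] := poly_step_itv n z01.
  rewrite /poly_step -exprMn exprn_ile1//; nra.
- exact: cvg_cst.
- exact: (@cvg_harmonic R).
Qed.

End PolynomialStep.

(** Any property stable under these three rules passes to the whole class by induction. The uniform
    bound [M] makes dominated convergence available in the limit rule. *)
Inductive trig_closure (R : realType) (d : nat) (P : probability (d.-tuple R) R) :
    (d.-tuple R -> R) -> Prop :=
  | trig_harmonic (a : R[i]) xi : trig_closure P (fun x => Re (a * char xi x))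
  | trigD u v : trig_closure P u -> trig_closure P v ->
      trig_closure P (fun x => u x + v x)
  | trig_lim (u_ : (d.-tuple R -> R)^nat) u (M : R) :
      (forall n, trig_closure P (u_ n)) -> (forall n x, `|u_ n x| <= M) ->
      bmeas u -> {ae P, forall x, u_ ^~ x @ \oo --> u x} -> trig_closure P u.

Section TrigClosure.
Context (R : realType) (d : nat) (P : probability (d.-tuple R) R).
Implicit Types (u v : d.-tuple R -> R).
Local Notation trig := (trig_closure P).

Lemma bmeas_harmonic (a : R[i]) xi :
  bmeas (fun x : d.-tuple R => Re (a * char xi x)).
Proof. by have [] := cmeasZ a (cmeas_char R xi). Qed.

Lemma trig_bmeas u : trig u -> bmeas u.
Proof.
elim => [a xi|{}u v _ bu _ bv|u_ {}u M _ _ _ //]; first exact: bmeas_harmonic.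
exact: bmeasD.
Qed.

(** The constant sequence [u] converges to [v] almost everywhere. *)
Lemma trig_ae u v : trig u -> bmeas v -> {ae P, forall x, u x = v x} -> trig v.
Proof.
move=> tu bv uv; have [_ [M uM]] := trig_bmeas tu.
apply: (@trig_lim _ _ _ (fun=> u) v M) => //.
by apply: filterS uv => x /= ->; exact: cvg_cst.
Qed.

Lemma trig_cst (c : R) : trig (fun=> c).
Proof.
have := trig_harmonic P (Complex c 0) 0.
by under eq_fun do rewrite char0 mulr1.
Qed.

(** Re z Re w is half of Re(z w) + Re(z conj(w)), and conjugating a character negates its
    frequency. *)
Lemma harmonicM (a b : R[i]) xi eta (x : d.-tuple R) :
  Re (a * char xi x) * Re (b * char eta x) =
  Re (a * b / 2 * char (xi + eta) x) +
  Re (a * Complex (Re b) (- Im b) / 2 * char (xi - eta) x).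
Proof.
have half (z w : R[i]) : Re (z / 2 * w) = Re (z * w) / 2.
  have e : Re (z * w) = Re (z / 2 * w) + Re (z / 2 * w).
    by rewrite -RecD -mulrDl -splitr.
  by rewrite e; field.
by rewrite !half !charD !ReImE Re_charN Im_charN /=; field.
Qed.

(** Induction on [u], and for harmonic [u] a second induction on [v]; in the limit cases the other
    factor is fixed and bounded. *)
Lemma trigM u v : trig u -> trig v -> trig (fun x => u x * v x).
Proof.
move=> tu tv; elim: tu v tv => [a xi|{}u u' _ IH _ IH'|u_ {}u M tu_ IH uM bu cu] v tv.
- elim: tv => [b eta|{}v v' _ IH _ IH'|v_ {}v M tv_ IH vM bv cv].
  + under eq_fun do rewrite harmonicM; apply: trigD; exact: trig_harmonic.
  + under eq_fun do rewrite mulrDr; exact: trigD.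
  + have bh := bmeas_harmonic a xi; have [_ [N hN]] := bh.
    apply: (@trig_lim _ _ _ (fun n x => Re (a * char xi x) * v_ n x) _ (N * M)) => //.
    * by move=> n x; rewrite normrM ler_pM.
    * exact: bmeasM.
    * by apply: filterS cv => x cx; exact: cvgMl_tmp.
- by under eq_fun do rewrite mulrDl; apply: trigD; [exact: IH|exact: IH'].
- have bv := trig_bmeas tv; have [_ [N vN]] := bv.
  apply: (@trig_lim _ _ _ (fun n x => u_ n x * v x) _ (M * N)) => //.
  + by move=> n; exact: IH.
  + by move=> n x; rewrite normrM ler_pM.
  + exact: bmeasM.
  + by apply: filterS cu => x cx; exact: cvgMr_tmp.
Qed.

Lemma trigZ (c : R) u : trig u -> trig (fun x => c * u x).
Proof. by apply: trigM; exact: trig_cst. Qed.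

Lemma trigB u v : trig u -> trig v -> trig (fun x => u x - v x).
Proof.
move=> tu tv; under eq_fun do rewrite -mulN1r.
by apply: trigD => //; exact: trigZ.
Qed.

Lemma trigX u n : trig u -> trig (fun x => u x ^+ n).
Proof.
move=> tu; elim: n => [|n IH]; first exact: trig_cst.
by under eq_fun do rewrite exprS; exact: trigM.
Qed.

(** An affine map sends the values of [u] into [0,1], with 0 going to 1/2 and positive values below
    1/2; [poly_step] then converges to the indicator. *)
Lemma trig_indic_gt0 u : trig u -> trig (\1_[set x | 0 < u x]).
Proof.
move=> tu; have [mu [M uM]] := trig_bmeas tu.
have mA : measurable [set x | 0 < u x].
  exact: measurable_ltr (measurable_cst _) mu.
(* Adding 1 keeps the divisor positive even if [M] is 0. *)
pose N := M + 1.
have N0 : 0 < N.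
  by have := le_trans (normr_ge0 _) (uM [tuple 0 | i < d]); rewrite /N; lra.
pose z x := 2^-1 - (2 * N)^-1 * u x.
have z01 x : 0 <= z x <= 1.
  have : `|(2 * N)^-1 * u x| <= 2^-1.
    rewrite normrM ger0_norm ?invr_ge0; last by lra.
    rewrite invfM -mulrA ger_pMr// mulrC ler_pdivrMr// mul1r.
    by rewrite (le_trans (uM x))// /N; lra.
  by rewrite ler_norml /z; lra.
have zlt x : (z x < 2^-1) = (0 < u x).
  by rewrite /z ltrBlDr ltrDl pmulr_rgt0// invr_gt0; lra.
apply: (@trig_lim _ _ _ (fun n x => poly_step n (z x)) _ 1).
- move=> n; apply: trigX; apply: trigB; first exact: trig_cst.
  apply: trigX; apply: trigB; [exact: trig_cst|exact: trigZ].
- move=> n x; have /andP[h0 h1] := poly_step_itv n (z01 x).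
  by rewrite ger0_norm.
- exact: bmeas_indic.
apply: aeW => x; rewrite indicE (_ : (x \in _) = (z x < 2^-1)).
  exact: cvg_poly_step.
by apply/idP/idP => [/set_mem|h]; [rewrite zlt|apply/mem_set; rewrite /= -zlt].
Qed.

Definition trig_set (A : set (d.-tuple R)) : Prop := measurable A /\ trig (\1_A).

(** Complements come from 1 minus an indicator, countable intersections from limits of finite
    products of indicators, and unions by de Morgan. *)
Lemma trig_sigma_algebra : sigma_algebra setT trig_set.
Proof.
have tC A : trig_set A -> trig_set (~` A).
  move=> [mA tA]; split; first exact: measurableC.
  rewrite (_ : \1__ = fun x => 1 - \1_A x); first exact: trigB (trig_cst 1) tA.
  apply/funext => x; rewrite !indicE in_setC.
  by case: (_ \in _); rewrite /= ?subrr ?subr0.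
split.
- by split => //; rewrite indic0; exact: trig_cst.
- by move=> A tA; rewrite setTD; exact: tC.
move=> A tA; rewrite -[X in trig_set X]setCK setC_bigcup; apply: (tC _).
have mA : measurable (\bigcap_k ~` A k).
  by apply: bigcap_measurable => //= k _; apply: measurableC; have [] := tA k.
split => //.
apply: (@trig_lim _ _ _ (fun n x => \prod_(k < n) \1_(~` A k) x) _ 1).
- elim => [|n IH]; first by under eq_fun do rewrite big_ord0; exact: trig_cst.
  under eq_fun do rewrite big_ord_recr/=; apply: trigM => //.
  by have [] := tC _ (tA n).
- move=> n x; rewrite normr_prod prodr_ile1// => i _; rewrite normr_ge0/=.
  by rewrite indicE; case: (_ \in _); rewrite ?normr1 ?normr0.
- exact: bmeas_indic.
apply: aeW => x; apply: cvg_near_cst.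
have [xA|] := pselect ((\bigcap_k ~` A k) x).
  apply: nearW => n; rewrite big1 ?indicE ?mem_set// => k _.
  by rewrite indicE mem_set//; exact: xA.
rewrite -setC_bigcup => /contrapT[k _ Akx].
near=> n; rewrite [RHS]indicE memNset; last by apply; exists k.
have kn : (k < n)%N by near: n; exists k.+1.
apply/eqP; rewrite prodf_seq_eq0; apply/hasP; exists (Ordinal kn).
  by rewrite mem_index_enum.
by rewrite /= indicE memNset// => /(_ Akx).
Unshelve. all: by end_near.
Qed.

End TrigClosure.

(** Expresses a half-line on the circle through signs of harmonics: the sine is negative exactly
    beyond 1/2, and the cosine decreases on the first half and increases on the second. *)
Lemma gt_cos_sin (R : realType) (a x : R) : 0 <= a < 1 -> 0 <= x < 1 ->
  (a < x) = if a < 2^-1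
    then (sin (2 * pi * x) < 0) || (cos (2 * pi * x) < cos (2 * pi * a))
    else (sin (2 * pi * x) < 0) && (cos (2 * pi * a) < cos (2 * pi * x)).
Proof.
move=> /andP[a0 a1] /andP[x0 x1]; have pi0 := pi_gt0 R.
have reflect_cos (y : R) : cos (2 * pi * y) = cos (2 * pi * (1 - y)).
  rewrite -[LHS]cosN -[LHS]cosD2pi; congr cos.
  by rewrite mulr2n; ring.
have sin_lt0 (y : R) : 0 <= y < 1 -> (sin (2 * pi * y) < 0) = (2^-1 < y).
  move=> /andP[y0 y1]; have [y2|y2] := ltP 2^-1 y.
    rewrite (_ : 2 * pi * y = pi * (2 * y - 1) + pi); last by ring.
    by rewrite sinDpi oppr_lt0 sin_gt0_pi//; apply/andP; split; nra.
  by apply/negbTE; rewrite -leNgt sin_ge0_pi//; apply/andP; split; nra.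
have cos_lt (y z : R) : 0 <= y <= 2^-1 -> 0 <= z <= 2^-1 ->
    (cos (2 * pi * y) < cos (2 * pi * z)) = (z < y).
  move=> /andP[y0 y2] /andP[z0 z2]; rewrite ltr_cos.
  - by rewrite ltr_pM2l//; lra.
  - by rewrite in_itv/=; apply/andP; split; nra.
  - by rewrite in_itv/=; apply/andP; split; nra.
rewrite sin_lt0 ?x0//; have [a2|a2] := ltP a 2^-1; have [x2|x2] := ltP 2^-1 x => /=.
- by rewrite (lt_trans a2 x2).
- by rewrite cos_lt//; apply/andP; split; lra.
- rewrite (reflect_cos a) (reflect_cos x) cos_lt; try by apply/andP; split; lra.
  by rewrite ltrD2l ltrN2.
- by apply/negbTE; rewrite -leNgt; lra.
Qed.

(** * Every bounded measurable function is a bounded limit of trigonometric polynomials *)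

Section TrigMeasurable.
Context (R : realType) (d : nat) (P : probability (d.-tuple R) R).
Implicit Types (u v : d.-tuple R -> R).
Local Notation trig := (trig_closure P).
Hypothesis ae_cube : {ae P, forall x : d.-tuple R, forall i, 0 <= tnth x i < 1}.

Lemma trig_set_gt0 u : trig u -> trig_set P [set x | 0 < u x].
Proof.
move=> tu; have [mu _] := trig_bmeas tu.
split; last exact: trig_indic_gt0.
exact: measurable_ltr (measurable_cst _) mu.
Qed.

Lemma trig_set_ae (A B : set (d.-tuple R)) : trig_set P A -> measurable B ->
  {ae P, forall x, A x <-> B x} -> trig_set P B.
Proof.
move=> [mA tA] mB AB; split => //; apply: (trig_ae tA); first exact: bmeas_indic.
apply: filterS AB => x [AB BA]; rewrite !indicE; congr (_%:R).
by congr nat_of_bool; apply/idP/idP => /set_mem h; apply/mem_set; auto.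
Qed.

Lemma trig_setC A : trig_set P A -> trig_set P (~` A).
Proof. by have [_ h _] := trig_sigma_algebra P; move=> /h; rewrite setTD. Qed.

Lemma trig_setU A B : trig_set P A -> trig_set P B -> trig_set P (A `|` B).
Proof.
move=> tA tB; have [_ _ h] := trig_sigma_algebra P.
by rewrite -bigcup2E; apply: h => -[|[|n]] //=; have [] := trig_sigma_algebra P.
Qed.

Lemma trig_setI A B : trig_set P A -> trig_set P B -> trig_set P (A `&` B).
Proof.
move=> tA tB; rewrite -[A `&` B]setCK setCI; apply/trig_setC/trig_setU; exact: trig_setC.
Qed.

Let dotZR_delta i (x : d.-tuple R) : dotZR (delta_mx 0 i) x = tnth x i.
Proof.
rewrite /dotZR (bigD1 i)//= big1 => [|j ji]; first by rewrite mxE !eqxx mul1r addr0.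
by rewrite mxE eqxx (negbTE ji) mul0r.
Qed.

Let trig_cos i : trig (fun x => cos (2 * pi * tnth x i)).
Proof.
have := trig_harmonic P 1 (delta_mx 0 i).
by under eq_fun do rewrite mul1r /= cosN dotZR_delta.
Qed.

Let trig_sin i : trig (fun x => sin (2 * pi * tnth x i)).
Proof.
have := trig_harmonic P (Complex 0 1) (delta_mx 0 i).
by under eq_fun do rewrite /= mul0r mul1r sinN opprK add0r dotZR_delta.
Qed.

(** For [a] outside [0,1[ the set is almost everywhere full or empty, by [ae_cube]; otherwise
    [gt_cos_sin] describes it by harmonics. *)
Lemma trig_set_coord_gt i (a : R) : trig_set P [set x | a < tnth x i].
Proof.
have mB : measurable [set x : d.-tuple R | a < tnth x i].
  exact: measurable_ltr (measurable_cst _) (measurable_tnth i).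
have [s0 _ _] := trig_sigma_algebra P.
have [a0|a0] := ltP a 0.
  apply: (trig_set_ae (trig_setC s0)) => //; apply: filterS ae_cube => x xI.
  by split=> [_ /=|_ []]; have := xI i; lra.
have [a1|a1] := leP 1 a.
  apply: (trig_set_ae s0) => //; apply: filterS ae_cube => x xI.
  by split=> [[]|/= ax]; have := xI i; lra.
have tneg u : trig u -> trig_set P [set x | u x < 0].
  move=> tu; have := trig_set_gt0 (trigB (trig_cst P 0) tu).
  by congr trig_set; apply/funext => x /=; rewrite sub0r oppr_gt0.
have sneg := tneg _ (trig_sin i).
have cos_a (b : R) := trig_cst P (cos (2 * pi * b)).
have [a2|a2] := ltP a 2^-1.
  have ccos := trig_set_gt0 (trigB (cos_a a) (trig_cos i)).
  apply: (trig_set_ae (trig_setU sneg ccos)) => //.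
  apply: filterS ae_cube => x xI /=; rewrite subr_gt0.
  rewrite (gt_cos_sin _ (xI i)) ?a0// a2; split; first by move=> [->|->]; rewrite ?orbT.
  by move=> /orP.
have ccos := trig_set_gt0 (trigB (trig_cos i) (cos_a a)).
apply: (trig_set_ae (trig_setI sneg ccos)) => //.
apply: filterS ae_cube => x xI /=; rewrite subr_gt0.
rewrite (gt_cos_sin _ (xI i)) ?a0// (le_gtF a2); split; first by move=> [-> ->].
by move=> /andP.
Qed.

(** The sigma-algebra of tuples is generated by the coordinates, and that of the line by open rays,
    so [trig_set_coord_gt] covers the generators. *)
Lemma measurable_trig_set (A : set (d.-tuple R)) : measurable A -> trig_set P A.
Proof.
apply: smallest_sub; first exact: trig_sigma_algebra.
apply: (big_ind (fun C => C `<=` trig_set P)) => [//|C D CP DP B [/CP|/DP]//|i _].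
rewrite /= [X in preimage_set_system _ _ X]RGenOInfty.measurableE -g_sigma_preimageE.
apply: smallest_sub; first exact: trig_sigma_algebra.
move=> _ [_ [a ->] <-]; rewrite setTI.
have := trig_set_coord_gt i a; congr trig_set; apply/funext => x /=.
by rewrite in_itv/= andbT.
Qed.

(** Binary expansion: removing the first digit of a function with values in [0,1] and doubling gives
    such a function again, and each digit halves the error. The general case follows by affine
    rescaling. *)
Lemma bmeas_trig : forall u, bmeas u -> trig u.
Proof.
have step u n : measurable_fun setT u -> (forall x, 0 <= u x <= 1) ->
    exists2 v, trig v & forall x, `|u x - v x| <= 2^-1 ^+ n.
  elim: n u => [|n IH] {}u mu u01.
    exists (fun=> 0); first exact: trig_cst.
    by move=> x; rewrite subr0 ger0_norm ?expr0; have /andP[] := u01 x.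
  (* The set where the first binary digit is 1. *)
  pose A := [set x | 2^-1 <= u x].
  have mA : measurable A.
    exact: measurable_ler (measurable_cst _) mu.
  have [|x|v tv uv] := IH (fun x => 2 * u x - \1_A x).
  - apply: measurable_funB; last exact: measurable_indic.
    by apply: measurable_funM => //; exact: measurable_cst.
  - have /andP[u0 u1] := u01 x; rewrite indicE.
    have [h|h] := leP 2^-1 (u x); first by rewrite mem_set//=; lra.
    by rewrite memNset/=; [lra|rewrite /A/=; lra].
  exists (fun x => 2^-1 * (\1_A x + v x)).
    by apply/trigZ/trigD => //; have [] := measurable_trig_set mA.
  move=> x; rewrite exprS.
  rewrite (_ : u x - _ = 2^-1 * (2 * u x - \1_A x - v x)); last by field.
  by rewrite normrM ger0_norm ?invr_ge0// ler_wpM2l ?invr_ge0.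
move=> u [mu [M uM]].
pose N := M + 1.
have N0 : 0 < N.
  by have := le_trans (normr_ge0 _) (uM [tuple 0 | i < d]); rewrite /N; lra.
pose w x := 2^-1 + (2 * N)^-1 * u x.
have w01 x : 0 <= w x <= 1.
  have : `|(2 * N)^-1 * u x| <= 2^-1.
    rewrite normrM ger0_norm ?invr_ge0; last by lra.
    rewrite invfM -mulrA ger_pMr// mulrC ler_pdivrMr// mul1r.
    by rewrite (le_trans (uM x))// /N; lra.
  by rewrite ler_norml /w; lra.
have mw : measurable_fun setT w.
  apply: measurable_funD; first exact: measurable_cst.
  by apply: measurable_funM => //; exact: measurable_cst.
have bw : bmeas w.
  by split => //; exists 1 => x; have /andP[w0 w1] := w01 x; rewrite ger0_norm.
suff tw : trig w.
  have := trigZ (2 * N) (trigB tw (trig_cst P 2^-1)).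
  congr trig_closure; apply/funext => x; rewrite /w; field; lra.
have /choice[v hv] : forall n, exists v, trig v /\ forall x, `|w x - v x| <= 2^-1 ^+ n.
  by move=> n; have [v tv vw] := step w n mw w01; exists v.
(* The bound 2 is the sum of [w <= 1] and an approximation error of at most 1. *)
apply: (@trig_lim _ _ _ v w 2) => //.
- by move=> n; have [] := hv n.
- move=> n x; have [_ /(_ x) h] := hv n; have /andP[w0 w1] := w01 x.
  have h1 : 2^-1 ^+ n <= 1 :> R by rewrite exprn_ile1// ?invr_ge0// invf_le1// ler1n.
  by move: h; rewrite ler_norml => ?; rewrite ler_norml; lra.
apply: aeW => x; apply/cvgrPdist_le => e e0.
have cg : (2^-1 : R) ^+ n @[n --> \oo] --> 0.
  by apply: cvg_expr; rewrite ger0_norm ?invr_ge0// invf_lt1// ltr1n.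
move/cvgrPdist_le : cg => /(_ _ e0); apply: filterS => n; rewrite sub0r normrN => h.
have [_ /(_ x) h1] := hv n; apply: le_trans h1 _.
by rewrite (le_trans _ h)// ler_norm.
Qed.

End TrigMeasurable.

(** * Jensen's inequality and the kernel estimate *)

Section Jensen.
Context (R : realType) (d : nat) (P : probability (d.-tuple R) R).
Variable S : set 'rV[int]_d.
Hypothesis halfS : is_halfspace S.
Hypothesis int_char : forall xi, xi != 0 -> cintegral P setT (char xi) = 0.
Hypothesis ae_cube : {ae P, forall x : d.-tuple R, forall i, 0 <= tnth x i < 1}.
Local Notation J := (cintegral P setT).

(** Of a nonzero frequency and its opposite one lies in [S]; conjugating the coefficient moves a
    harmonic from one to the other without changing its real part. *)
Lemma trig_tilt_stable u : trig_closure P u -> tilt_stable P S u.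
Proof.
elim => [a xi|{}u v tu su tv sv|u_ {}u M tu su u_M bu cu].
- have [->|xi0] := eqVneq xi 0.
    by under eq_fun do rewrite char0; exact: tilt_stable_cst.
  have [_ /(_ _ xi0)[Sxi|Sxi] _] := halfS; first exact: tilt_stable_analytic.
  rewrite (_ : (fun _ => _) =
      (fun x => Re (Complex (Re a) (- Im a) * char (- xi) x))).
    exact: tilt_stable_analytic.
  by apply/funext => x; rewrite !RecM Re_charN Im_charN/=; ring.
- by apply: tilt_stableD => //; exact: trig_bmeas tu || exact: trig_bmeas tv.
- by apply: tilt_stable_lim bu _ u_M cu su => n; have [] := trig_bmeas (tu n).
Qed.

Lemma bmeas_ln w (e : R) : 0 < e -> bmeas w -> (forall x : d.-tuple R, e <= w x) ->
  bmeas (fun x => ln (w x)).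
Proof.
move=> e0 [mw [B wB]] ew; split.
  by apply: (measurableT_comp _ mw); exact: measurable_ln.
exists (`|ln e| + `|ln B|) => x.
have wx0 : 0 < w x by exact: lt_le_trans e0 (ew x).
have wxB : w x <= B by exact: le_trans (ler_norm _) (wB x).
have B0 := lt_le_trans wx0 wxB.
have h1 : ln e <= ln (w x) by rewrite ler_ln.
have h2 : ln (w x) <= ln B by rewrite ler_ln.
have := ler_norm (ln B); have := lerNnormlW (lexx `|ln e|).
have := normr_ge0 (ln B); have := normr_ge0 (ln e).
rewrite ler_norml; lra.
Qed.

(** Tilting [w] by u = log w turns the weight into the constant exp of the integral of log w, and
    testing with F = 1 reads off the inequality. *)
Lemma helson_lowdenslager_jensen (h : d.-tuple R -> R[i]) (e : R) : cmeas h -> 0 < e ->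
  (forall xi, S xi -> J (fun x => h x * char xi x) = 0) ->
  sqnormc (J h) <= expR (\int[P]_x ln (sqnormc (h x) + e)).
Proof.
move=> ch e0 h0.
have bw : bmeas (fun x => sqnormc (h x) + e).
  by apply: bmeasD; [exact: bmeas_sqnormc|exact: bmeas_cst].
have ew x : e <= sqnormc (h x) + e by rewrite lerDr sqnormc_ge0.
have bl := bmeas_ln e0 bw ew.
have w0 x : 0 < sqnormc (h x) + e by exact: lt_le_trans (ew x).
apply: le_trans (trig_tilt_stable (bmeas_trig ae_cube bl) bw (fun x => ltW (w0 x))
  (szego_sqnormc halfS ch (ltW e0) h0) (@analytic1 R d S)) _.
rewrite le_eqVlt -[X in _ == X](Rint_cst P); apply/orP; left; apply/eqP.
apply: eq_Rintegral => x _.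
rewrite {1}/sqnormc /= expr0n /= addr0 expr1n mul1r opprB expRD expRN lnK ?posrE//.
by rewrite mulrCA divff ?mulr1// gt_eqF.
Qed.

End Jensen.

(** * The Dirichlet kernel bounded by a logarithm *)

Section Kernel.
Context (R : realType).

Lemma ln_ge_1V (x : R) : 0 < x -> 1 - x^-1 <= ln x.
Proof.
move=> x0; have xV0 : 0 < x^-1 by rewrite invr_gt0.
by have := @le_ln1Dx R (x^-1 - 1); rewrite (addrC 1) subrK lnV ?posrE//; lra.
Qed.

(* With [r = D / N] and [W = H + 4 / N^2], the hypotheses give [W <= 5] and
   [W <= 8 / (N r)^2]; the bound is the [(1 - r, r)] convex combination of the
   logarithms of these two. *)
Lemma kernel_bound (N : nat) (D H : R) : (2 <= N)%N -> 0 <= D <= N%:R ->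
  0 <= H <= 4 -> D ^+ 2 * H <= 4 ->
  2 * (D / N%:R) * ln N%:R <= ln 256 - ln (H + 4 / N%:R ^+ 2).
Proof.
move=> N2 /andP[D0 DN] /andP[H0 H4] DH; set n : R := N%:R.
have n2 : 2 <= n by rewrite ler_nat.
have n0 : 0 < n by lra.
have q1 : 4 / n ^+ 2 <= 1 by rewrite ler_pdivrMr ?exprn_gt0//; nra.
have q0 : 0 < 4 / n ^+ 2 by rewrite divr_gt0 ?exprn_gt0.
set W := H + _; have W0 : 0 < W by rewrite /W; lra.
have W8 : W <= 8 by rewrite /W; lra.
have l256 : ln 256 = 8 * ln 2 :> R.
  by rewrite (_ : 256 = 2 ^+ 8) ?lnXn// ?mulr_natl//; rewrite -natrX.
have l8 : ln 8 = 3 * ln 2 :> R.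
  by rewrite (_ : 8 = 2 ^+ 3) ?lnXn// ?mulr_natl//; rewrite -natrX.
have l2 : 2^-1 <= ln 2 :> R by have := @ln_ge_1V 2; lra.
have lW8 : ln W <= ln 8 by rewrite ler_ln ?posrE//.
(* [D = 0] is set apart because the argument takes the logarithm of [r]. *)
have [->|Dneq0] := eqVneq D 0; first by rewrite mul0r mulr0 mul0r; lra.
set r := D / n; have r0 : 0 < r by rewrite divr_gt0// lt_def Dneq0.
have r1 : r <= 1 by rewrite ler_pdivrMr// mul1r.
have rW : n ^+ 2 * r ^+ 2 * W <= 8.
  rewrite (_ : _ * W = D ^+ 2 * H + 4 * r ^+ 2); first by nra.
  rewrite /W /r; field; lra.
have lrW : 2 * ln n + 2 * ln r + ln W <= ln 8.
  have ln_sqrM (x y z : R) : 0 < x -> 0 < y -> 0 < z ->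
      2 * ln x + 2 * ln y + ln z = ln (x ^+ 2 * y ^+ 2 * z).
    move=> x0 y0 z0; have xy0 : 0 < x ^+ 2 * y ^+ 2 by rewrite mulr_gt0 ?exprn_gt0.
    by rewrite expr2 expr2 !lnM ?posrE ?mulr_gt0//; ring.
  rewrite (ln_sqrM n r W n0 r0 W0) ler_ln ?posrE//.
  exact: mulr_gt0 (mulr_gt0 (exprn_gt0 _ n0) (exprn_gt0 _ r0)) W0.
have lr : r - 1 <= r * ln r.
  have := ln_ge_1V r0; rewrite -(ler_pM2l r0) mulrBr mulr1 divff//; exact: lt0r_neq0.
(* The convex combination leaves an error -2 r ln r, at most 2 by [lr], and ln 8 + 2 <= ln 256 since
   ln 2 >= 1/2. *)
nra.
Qed.

Lemma geometric_sum (s : R[i]) (M N : nat) :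
  (s - 1) * \sum_(M <= m < M + N) s ^+ m = s ^+ (M + N) - s ^+ M.
Proof.
elim: N => [|N IH]; first by rewrite addn0 big_geq// mulr0 subrr.
by rewrite addnS big_nat_recr/= ?leq_addr// mulrDr IH exprS; ring.
Qed.

Lemma normc_sum_le (r : seq nat) (F : nat -> R[i]) :
  normc (\sum_(i <- r) F i) <= \sum_(i <- r) normc (F i).
Proof.
elim: r => [|i r IH]; first by rewrite !big_nil ComplexField.Normc.normc0.
by rewrite !big_cons (le_trans (ler_normcD _ _))// lerD.
Qed.

(** The trivial bound and the telescoped geometric series; the second is stated as a product so that
    s = 1 is included. *)
Lemma dirichlet_bound (s : R[i]) (M N : nat) : normc s = 1 ->
  normc (\sum_(M <= m < M + N) s ^+ m) <= N%:R /\
  normc (s - 1) * normc (\sum_(M <= m < M + N) s ^+ m) <= 2.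
Proof.
move=> s1; have sX m : normc (s ^+ m) = 1 by rewrite normcX s1 expr1n.
split.
  apply: le_trans (normc_sum_le _ _) _; under eq_bigr do rewrite sX.
  by rewrite sumr_const_nat addKn.
rewrite -ComplexField.Normc.normcM geometric_sum (le_trans (ler_normcD _ _))//.
by rewrite normcN !sX -[leRHS]/(1 + 1).
Qed.

End Kernel.

(** * The mean square bound for [f] bounded by 1 everywhere *)

Section MeanSquareBound.
Context (R : realType) (d : nat) (P : probability (d.-tuple R) R).
Variables (S : set 'rV[int]_d) (nu : 'rV[int]_d) (f e : d.-tuple R -> R[i]).
Hypothesis halfS : is_halfspace S.
Hypothesis int_char : forall xi, xi != 0 -> cintegral P setT (char xi) = 0.
Hypothesis ae_cube : {ae P, forall x : d.-tuple R, forall i, 0 <= tnth x i < 1}.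
Hypotheses (cf : cmeas f) (f1 : forall x, normc (f x) <= 1).
Hypotheses (ce : cmeas e) (e1 : forall x, normc (e x) = 1).
Local Notation J := (cintegral P setT).
Hypothesis f0 : forall xi, S xi -> J (fun x => f x * char xi x) = 0.
Hypothesis Snu : S (- nu).
Hypothesis Jf0 : J f != 0.

Let E := [set x | normc (f x) = 1].
(** The integrand of the [m]-th coefficient, extended by zero off [E]; the unimodular [e] stands for
    the character that carries the shift [k]. *)
Let F (m : nat) x : R[i] := Complex (\1_E x) 0 * ((f x * char nu x) ^+ m * e x).

Lemma measurable_normc1 : measurable E.
Proof.
have [ms _] := bmeas_sqnormc cf.
rewrite (_ : E = (fun x => sqnormc (f x)) @^-1` [set 1]).
  by rewrite -[X in measurable X]setTI; apply: ms => //; exact: measurable_set1.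
apply/seteqP; split=> x /=; rewrite /E/=.
  by rewrite -normcEsqr => ->; rewrite expr1n.
by rewrite normcEsqrt => ->; rewrite sqrtr1.
Qed.

Let cF m : cmeas (F m).
Proof.
have cg : cmeas (fun x => f x * char nu x) by apply: cmeasM => //; exact: cmeas_char.
apply: cmeasM; last by apply: cmeasM => //; exact: cmeasX.
split => /=; [exact: bmeas_indic measurable_normc1|exact: bmeas_cst].
Qed.

Let cconst (c : R[i]) : cmeas (fun x => f x - c * char (- nu) x).
Proof.
under eq_fun do rewrite -mulNr.
by apply: cmeasD => //; apply: cmeasZ; exact: cmeas_char.
Qed.

(** Since [- nu] lies in [S], subtracting a multiple of [char (- nu)] changes neither the mean nor
    the orthogonality to [S]: the characters that arise have frequencies in [S], hence nonzero, and
    integrate to 0. *)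
Lemma shifted_jensen (c : R[i]) (eps : R) : 0 < eps ->
  ln (sqnormc (J f)) <= \int[P]_x ln (sqnormc (f x - c * char (- nu) x) + eps).
Proof.
move=> eps0; have [_ _ SD] := halfS; have S_neq0 := halfspace_neq0 halfS.
have cc xi : cmeas (fun x : d.-tuple R => - c * char xi x).
  by apply: cmeasZ; exact: cmeas_char.
have cfx xi : cmeas (fun x => f x * char xi x).
  by apply: cmeasM => //; exact: cmeas_char.
have := @helson_lowdenslager_jensen _ _ _ _ halfS int_char ae_cube _ _ (cconst c) eps0.
have -> : J (fun x => f x - c * char (- nu) x) = J f.
  under eq_fun do rewrite -mulNr.
  rewrite cintD// cintZ; last exact: cmeas_char.
  by rewrite int_char ?mulr0 ?addr0// S_neq0.
move=> h; rewrite -[leRHS]expRK ler_ln ?posrE ?expR_gt0//.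
  apply: h => xi Sxi.
  have -> : (fun x => (f x - c * char (- nu) x) * char xi x) =
      (fun x => f x * char xi x + - c * char (- nu + xi) x).
    by apply/funext => x; rewrite charD; ring.
  rewrite cintD// f0// cintZ; last exact: cmeas_char.
  by rewrite int_char ?mulr0 ?addr0//; apply/S_neq0/SD.
rewrite lt_def sqnormc_ge0 andbT; apply: contra Jf0 => /eqP s0.
by apply/eqP/ComplexField.Normc.eq0_normc; rewrite normcEsqrt s0 sqrtr0.
Qed.

Let cj (z : R[i]) : R[i] := Complex (Re z) (- Im z).

Let cj_def z : cj z = (z^*)%C. Proof. by case: z. Qed.
Let cjM z w : cj (z * w) = cj z * cj w. Proof. by rewrite !cj_def rmorphM. Qed.
Let cjX z n : cj (z ^+ n) = cj z ^+ n. Proof. by rewrite !cj_def rmorphXn. Qed.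
Let normc_cj z : normc (cj z) = normc z.
Proof. by rewrite !normcEsqrt /sqnormc /= sqrrN. Qed.
Let mul_cj z : cj z * z = Complex (sqnormc z) 0.
Proof. by apply: complex_ext; rewrite !ReImE /sqnormc/=; ring. Qed.
Let cjK z : cj (cj z) = z.
Proof. by case: z => a b; rewrite /cj/= opprK. Qed.

(** For [y] in [E] the sum is a unimodular constant times a geometric sum of ratio [s], and |s - 1|
    is the modulus of the function whose logarithm appears; [dirichlet_bound] feeds
    [kernel_bound]. *)
Lemma correlation_bound (M N : nat) (x y : d.-tuple R) : (2 <= N)%N -> E x ->
  normc (\sum_(M <= m < M + N) cj (F m x) * F m y) <=
  N%:R / (2 * ln N%:R) * (ln 256 - ln (sqnormc (f y - f x * char nu x * char (- nu) y)
    + 4 / N%:R ^+ 2)).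
Proof.
move=> N2 Ex; set c := f x * char nu x.
have n2 : 2 <= N%:R :> R by rewrite ler_nat.
have L0 : 0 < ln N%:R :> R by rewrite ln_gt0//; lra.
have c1 : normc c = 1 by rewrite ComplexField.Normc.normcM normc_char mulr1.
set h := f y - _; set D := normc _.
have h2 : normc h <= 2.
  apply: le_trans (ler_normcD _ _) _.
  rewrite normcN !ComplexField.Normc.normcM !normc_char !mulr1 Ex.
  by have := f1 y; lra.
have D0 : 0 <= D by exact: normc_ge0.
have [DN Dh] : D <= N%:R /\ normc h * D <= 2.
  have [Ey|nEy] := pselect (E y); last first.
    rewrite /D big1 => [|m _]; last first.
      by rewrite {2}/F indicE memNset// mul0r mulr0.
    by rewrite ComplexField.Normc.normc0 mulr0; split; lra.
  pose g := f y * char nu y; pose s := cj c * g.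
  have g1 : normc g = 1 by rewrite ComplexField.Normc.normcM normc_char mulr1.
  have -> : D = normc (\sum_(M <= m < M + N) s ^+ m).
    rewrite /D (_ : \sum_(_ <= _ < _) _ =
        cj (e x) * e y * \sum_(M <= m < M + N) s ^+ m).
      by rewrite !ComplexField.Normc.normcM normc_cj !e1 !mul1r.
    rewrite mulr_sumr; apply: eq_bigr => m _.
    have FE z : E z -> F m z = (f z * char nu z) ^+ m * e z.
      move=> Ez; rewrite /F indicE mem_set//=.
      by apply: complex_ext; rewrite !ReImE /=; ring.
    by rewrite !FE// -/c -/g cjM cjX /s [(cj c * g) ^+ m]exprMn; ring.
  (* Multiplication by the unimodular [char nu y] turns [h] into [g - c], and by conj(c) into
     [s - 1]. *)
  have -> : normc h = normc (s - 1).
    have -> : normc (s - 1) = normc (g - c).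
      rewrite -[LHS]mul1r -c1 -ComplexField.Normc.normcM; congr (normc _).
      rewrite mulrBr mulr1 /s mulrA [c * _]mulrC mul_cj -normcEsqr c1 expr1n.
      by rewrite -[Complex 1 0]/(1 : R[i]) mul1r.
    rewrite -[LHS]mulr1 -(normc_char nu y) -ComplexField.Normc.normcM; congr (normc _).
    by rewrite /h mulrBl -[_ * char nu y in X in _ - X]mulrA -charD addNr char0 mulr1.
  apply: dirichlet_bound.
  by rewrite ComplexField.Normc.normcM normc_cj c1 g1 mulr1.
have hh : 0 <= sqnormc h <= 4.
  rewrite sqnormc_ge0/= -normcEsqr; have := normc_ge0 h; nra.
have Dh4 : D ^+ 2 * sqnormc h <= 4.
  rewrite -normcEsqr -exprMn mulrC.
  have : 0 <= normc h * D by rewrite mulr_ge0// normc_ge0.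
  by nra.
have DN' : 0 <= D <= N%:R by rewrite D0.
rewrite [leLHS](_ : _ = N%:R / (2 * ln N%:R) * (2 * (D / N%:R) * ln N%:R)).
  by rewrite ler_wpM2l ?divr_ge0 ?mulr_ge0 ?ler0n ?(ltW L0)//; exact: kernel_bound.
by field; apply/andP; split; lra.
Qed.

(** Duality: the sum of squares is the integral of [G], and conj(G x) is the integral over y of the
    correlation sum, which is bounded by [K] uniformly in [x]. *)
Lemma mean_square_bound (M N : nat) : (2 <= N)%N ->
  N%:R^-1 * \sum_(M <= m < M + N) normc (J (F m)) ^+ 2 <=
  ln (16 / normc (J f) ^+ 4) / ln N%:R.
Proof.
move=> N2; have n2 : 2 <= N%:R :> R by rewrite ler_nat.
have L0 : 0 < ln N%:R :> R by rewrite ln_gt0//; lra.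
have n0 : 0 < N%:R :> R by lra.
set a := normc (J f).
have a1 : a <= 1 by exact: normc_cint_le_cst.
have a0 : 0 < a.
  rewrite lt_def normc_ge0 andbT; apply: contra Jf0 => /eqP.
  by move/ComplexField.Normc.eq0_normc => ->.
have la : ln a <= 0 by rewrite ln_le0.
(* What [correlation_bound] gives after integration in [y], by [shifted_jensen] with eps = 4 /
   N^2. *)
pose K := N%:R / (2 * ln N%:R) * (ln 256 - ln (a ^+ 2)).
have K0 : 0 <= N%:R / (2 * ln N%:R) :> R.
  by rewrite divr_ge0 ?mulr_ge0 ?ler0n ?(ltW L0).
have eps0 : 0 < 4 / N%:R ^+ 2 :> R by rewrite divr_gt0 ?exprn_gt0.
have corr x : E x -> normc (J (fun y => \sum_(M <= m < M + N) cj (F m x) * F m y)) <= K.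
  move=> Ex; pose c := f x * char nu x.
  pose w y := sqnormc (f y - c * char (- nu) y) + 4 / N%:R ^+ 2.
  have bw : bmeas w by apply: bmeasD; [exact: bmeas_sqnormc|exact: bmeas_cst].
  have bl : bmeas (fun y => ln (w y)).
    by apply: (bmeas_ln eps0 bw) => y; rewrite lerDr sqnormc_ge0.
  have bB : bmeas (fun y => ln 256 - ln (w y)) by apply: bmeasB => //; exact: bmeas_cst.
  apply: le_trans (normc_cint_le P _ (bmeasZ (N%:R / (2 * ln N%:R)) bB) _) _.
  - by apply: cmeas_sum => m; exact: cmeasZ.
  - by move=> y; exact: correlation_bound.
  rewrite RintZ// RintB//; last exact: bmeas_cst.
  rewrite Rint_cst ler_wpM2l// lerD2l lerN2 normcEsqr; exact: shifted_jensen.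
have sum_le : \sum_(M <= m < M + N) normc (J (F m)) ^+ 2 <= K.
  pose G x := \sum_(M <= m < M + N) cj (J (F m)) * F m x.
  have cG : cmeas G by apply: cmeas_sum => m; exact: cmeasZ.
  have JG : J G = \sum_(M <= m < M + N) cj (J (F m)) * J (F m).
    rewrite cint_sum => [|m]; last exact: cmeasZ.
    by apply: eq_bigr => m _; rewrite cintZ.
  have -> : \sum_(M <= m < M + N) normc (J (F m)) ^+ 2 = Re (J G).
    rewrite JG (big_morph (@complex.Re R) (@RecD R) (erefl : Re 0 = 0)).
    by apply: eq_bigr => m _; rewrite mul_cj normcEsqr.
  apply: le_trans (ler_norm _) (le_trans (normr_Re_le _) _).
  apply: normc_cint_le_cst => // x.
  (* Off [E] the sum vanishes, and [K] is nonnegative because [a <= 1]. *)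
  have [Ex|nEx] := pselect (E x); last first.
    rewrite /G big1 => [|m _]; last by rewrite /F indicE memNset// mul0r mulr0.
    rewrite ComplexField.Normc.normc0 mulr_ge0// subr_ge0 ler_ln ?posrE ?exprn_gt0//.
    by rewrite (le_trans (exprn_ile1 2 (ltW a0) a1))// ler1n.
  rewrite -normc_cj (_ : cj (G x) = J (fun y => \sum_(M <= m < M + N) cj (F m x) * F m y)).
    exact: corr.
  rewrite cint_sum => [|m]; last exact: cmeasZ.
  rewrite cj_def /G rmorph_sum/=; apply: eq_bigr => m _.
  by rewrite cintZ// -cj_def cjM cjK mulrC.
apply: le_trans (ler_wpM2l _ sum_le) _; first by rewrite invr_ge0 ltW.
rewrite ler_pdivlMr// /K.
have -> : N%:R^-1 * (N%:R / (2 * ln N%:R) * (ln 256 - ln (a ^+ 2))) * ln N%:R =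
    2^-1 * (ln 256 - ln (a ^+ 2)) by field; apply/andP; split; lra.
(* The bound obtained is ln 16 - ln a, at most ln 16 - 4 ln a because ln a <= 0. *)
rewrite ln_div ?posrE ?exprn_gt0// (lnXn 2 a0) (lnXn 4 a0).
have -> : ln 256 = ln 16 *+ 2 :> R.
  by rewrite (_ : 256 = 16 ^+ 2) ?lnXn//; rewrite -natrX.
lra.
Qed.

End MeanSquareBound.

(** * The measure of the torus *)

Section UnitIntervalMeasure.
Context (R : realType).
Let m := mrestr (@lebesgue_measure R) (measurable_itv `[0%R, 1%R[).

Let leb01_0 : @leb01 R set0 = 0%E. Proof. exact: (measure0 m). Qed.

Let leb01_ge0 A : (0 <= @leb01 R A)%E. Proof. exact: (measure_ge0 m). Qed.

Let leb01_sigma_additive : semi_sigma_additive (@leb01 R).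
Proof. exact: (@measure_semi_sigma_additive _ _ _ m). Qed.

HB.instance Definition _ := isMeasure.Build _ _ _ (@leb01 R)
  leb01_0 leb01_ge0 leb01_sigma_additive.

Let leb01_setT : @leb01 R setT = 1%E.
Proof. by rewrite /leb01 setTI lebesgue_measure_itv/= lte01 sube0. Qed.

HB.instance Definition _ := Measure_isProbability.Build _ _ _
  (@leb01 R) leb01_setT.

End UnitIntervalMeasure.

(* Lebesgue measure lives on [measurableTypeR R], whose display differs from the
   one of [R] used by [leb01]. *)
Definition of_measurableTypeR (R : realType) : measurableTypeR R -> R := idfun.

HB.instance Definition _ (R : realType) :=
  @isMeasurableFun.Build _ _ _ _ (@of_measurableTypeR R) (@measurable_id _ _ setT).

(** * Integration over the unit interval *)

Section UnitInterval.
Context (R : realType).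

(** Gives access to the integration rules of the uniform law, which lives on the closed interval;
    the extra endpoint is null. *)
Lemma leb01_uniform (A : set R) : measurable A ->
  @leb01 R A = uniform_prob (@ltr01 R) A.
Proof.
move=> mA; rewrite /uniform_prob integral_uniform_pdf.
rewrite (eq_integral (fun=> 1%:E)); last first.
  move=> x; rewrite inE/= => -[_]; rewrite in_itv/= /uniform_pdf => ->.
  by rewrite subr0 invr1.
rewrite integral_cst//=; last exact: measurableI.
rewrite mul1e /leb01.
have := @integral_itv_bndo_bndc R (BLeft 0) 1 (EFin \o \1_A).
rewrite !integral_indic//; apply.
by apply: measurable_funTS; apply/measurable_EFinP; exact: measurable_indic.
Qed.

Lemma Rintegral_leb01 (f F : R -> R) (M : R) :
  (forall x : R, is_derive x (1 : R) F (f x)) -> continuous f -> (forall x, `|f x| <= M) ->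
  \int[@leb01 R]_x f x = F 1 - F 0.
Proof.
move=> dF cf fM.
have mf : measurable_fun setT f by exact: continuous_measurable_fun.
have bf : bmeas f by split => //; exists M.
(* Adding [M] makes the integrand nonnegative, as the rules for image measures and for the uniform
   law require. *)
suff : \int[@leb01 R]_x (f x + M) = F 1 - F 0 + M.
  rewrite RintD//; last exact: bmeas_cst.
  by rewrite Rint_cst => /addIr.
pose U := distribution (uniform_prob (@ltr01 R)) (@of_measurableTypeR R).
have unif : (\int[@leb01 R]_x (f x + M)%:E = \int[U]_x (f x + M)%:E)%E.
  by apply: eq_measure_integral => A mA _; exact: leb01_uniform.
have mfM : measurable_fun setT (fun x => (f x + M)%:E).
  by apply/measurable_EFinP; apply: measurable_funD.
have fM0 x : (0 <= (f x + M)%:E)%E.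
  by rewrite lee_fin; have := fM x; rewrite ler_norml; lra.
rewrite /Rintegral unif ge0_integral_distribution// integral_uniform//.
rewrite subr0 invr1 mul1e.
pose G x := F x + M * x.
have dG (x : R) : is_derive x (1 : R) G (f x + M).
  have dM : is_derive x (1 : R) (M \*: (@id R)) (M *: (1 : R)) by apply: is_deriveZ.
  have := @is_deriveD _ _ _ F (M \*: (@id R)) x 1 (f x) (M *: (1 : R)) (dF x) dM.
  by rewrite /GRing.scale /= mulr1.
have cG : continuous G.
  by move=> x; apply/differentiable_continuous/derivable1_diffP; case: (dG x).
rewrite (@continuous_FTC2 _ _ G)//=.
- rewrite /G; ring.
- by apply: continuous_subspaceT => x; apply: cvgD; [exact: cf|exact: cvg_cst].
- split; first by move=> x _; case: (dG x).
  + exact: cvg_at_right_filter (cG 0).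
  + exact: cvg_at_left_filter (cG 1).
- by move=> x _; rewrite derive1E; case: (dG x).
Qed.

End UnitInterval.

(** * The torus measure as an iterated product *)

Section TorusMeasure.
Context (R : realType).

Lemma trig_2pi_int (m : int) :
  cos (- (2 * pi * m%:~R)) = 1 :> R /\ sin (- (2 * pi * m%:~R)) = 0 :> R.
Proof.
have nat_case (n : nat) : cos (2 * pi * n%:R) = 1 :> R /\ sin (2 * pi * n%:R) = 0 :> R.
  have -> : 2 * pi * n%:R = 0 + (pi *+ 2) *+ n :> R.
    by rewrite add0r mulr_natr; congr (_ *+ _); rewrite mulr_natl.
  by rewrite (periodicn (@cosD2pi R)) (periodicn (@sinD2pi R)) cos0 sin0.
case: m => n; first by rewrite cosN sinN; have [-> ->] := nat_case n; rewrite oppr0.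
by rewrite NegzE mulrNz mulrN opprK; exact: nat_case.
Qed.

Lemma Rintegral_leb01_trig (m : int) : m != 0 ->
  \int[@leb01 R]_x cos (- (2 * pi * (m%:~R * x))) = 0 /\
  \int[@leb01 R]_x sin (- (2 * pi * (m%:~R * x))) = 0.
Proof.
move=> m0; pose a : R := - (2 * pi * m%:~R).
have a0 : a != 0.
  by rewrite oppr_eq0 !mulf_neq0 ?pnatr_eq0 ?intr_eq0// gt_eqF// pi_gt0.
have ax (x : R) : - (2 * pi * (m%:~R * x)) = a * x by rewrite mulrA mulNr.
have [cos_a sin_a] : cos a = 1 /\ sin a = 0 by exact: trig_2pi_int.
have dax (x : R) : is_derive x (1 : R) (fun y => a * y) a.
  have := @is_deriveZ _ _ _ id a x 1 1 (is_derive_id _ _).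
  by rewrite /GRing.scale /= mulr1.
have cax : continuous (fun y : R => a * y).
  by move=> x; apply/differentiable_continuous/derivable1_diffP; case: (dax x).
have dcos (x : R) : is_derive x (1 : R) (fun y => cos (a * y)) (- sin (a * x) * a).
  exact: (@is_derive1_comp _ cos _ x _ _ (is_derive_cos _) (dax x)).
have dsin (x : R) : is_derive x (1 : R) (fun y => sin (a * y)) (cos (a * x) * a).
  exact: (@is_derive1_comp _ sin _ x _ _ (is_derive_sin _) (dax x)).
have dS (x : R) : is_derive x (1 : R) (fun y => a^-1 * sin (a * y)) (cos (a * x)).
  have := @is_deriveZ _ _ _ (fun y => sin (a * y)) a^-1 x 1 _ (dsin x).
  by rewrite /GRing.scale /= mulrCA mulVf// mulr1.
have dC (x : R) : is_derive x (1 : R) (fun y => - a^-1 * cos (a * y)) (sin (a * x)).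
  have := @is_deriveZ _ _ _ (fun y => cos (a * y)) (- a^-1) x 1 _ (dcos x).
  by rewrite /GRing.scale /= mulNr mulNr mulrN opprK mulrCA mulVf// mulr1.
have ccos : continuous (fun y : R => cos (a * y)).
  by move=> x; apply: continuous_comp; [exact: cax|exact: continuous_cos].
have csin : continuous (fun y : R => sin (a * y)).
  by move=> x; apply: continuous_comp; [exact: cax|exact: continuous_sin].
split; under eq_Rintegral do rewrite ax.
  rewrite (Rintegral_leb01 dS ccos (fun x => cos_max (a * x))).
  by rewrite mulr1 mulr0 sin_a sin0 mulr0 subrr.
rewrite (Rintegral_leb01 dC csin (fun x => sin_max (a * x))).
by rewrite mulr1 mulr0 cos_a cos0 subrr.
Qed.

Definition tuple_cons n (p : R * n.-tuple R) : n.+1.-tuple R :=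
  [tuple of p.1 :: p.2].

HB.instance Definition _ n := @isMeasurableFun.Build _ _ _ _ (@tuple_cons n)
  (measurable_cons measurable_fst measurable_snd).

Lemma Rintegral_torusS n (P : probability (n.-tuple R) R) (u : n.+1.-tuple R -> R) :
  bmeas u ->
  \int[distribution (@leb01 R \x P)%E (@tuple_cons n)]_x u x =
  \int[@leb01 R]_x \int[P]_y u (tuple_cons (x, y)).
Proof.
move=> bu.
have buc : bmeas (u \o @tuple_cons n).
  by have [mu [M uM]] := bu; split; [exact: measurableT_comp|exists M => x; exact: uM].
have mu : measurable_fun setT u by have [] := bu.
rewrite {1}/Rintegral integral_distribution; last 2 first.
- exact/measurable_EFinP.
- exact: (bmeas_integrable (@leb01 R \x P)%E buc).
rewrite -integral12_prod_meas1; last exact: (bmeas_integrable (@leb01 R \x P)%E buc).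
rewrite /fubini_F /Rintegral; congr fine; apply: eq_integral => x _.
rewrite fineK//; apply: integrable_fin_num => //; apply: bmeas_integrable.
have [muc [M ucM]] := buc; split; last by exists M => y; exact: ucM.
by apply: (measurableT_comp muc); exact: measurable_pair1.
Qed.

(** [torus_measure] is a bare set function; the induction builds a probability equal to it, together
    with the two facts about it that the analytic part assumes. *)
Lemma torus_probability n : exists P : probability (n.-tuple R) R,
  [/\ @torus_measure R n = P,
      {ae P, forall x : n.-tuple R, forall i, 0 <= tnth x i < 1} &
      forall xi, xi != 0 -> cintegral P setT (char xi) = 0].
Proof.
elim: n => [|n [P [PE Pcube Pchar]]].
  exists (dirac [tuple]); split => //.
    by apply: aeW => x [].
  by move=> xi /negP; case; apply/eqP/rowP => -[].
exists (distribution (@leb01 R \x P)%E (@tuple_cons n)); split.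
- by rewrite /= PE.
- have m01 : measurable (~` `[0, 1[%classic : set R).
    by apply: measurableC; exact: measurable_itv.
  have ae_head : {ae distribution (@leb01 R \x P)%E (@tuple_cons n),
      forall x : n.+1.-tuple R, 0 <= tnth x ord0 < 1}.
    exists ((fun x : n.+1.-tuple R => tnth x ord0) @^-1` (~` `[0, 1[%classic)); split.
    + by rewrite -[X in measurable X]setTI; exact: measurable_tnth.
    + rewrite /distribution /pushforward /=.
      rewrite (_ : _ @^-1` _ = (~` `[0, 1[%classic) `*` setT); last first.
        by apply/seteqP; split=> [[x y] /= h|[x y] /= [h _]]; [split|].
      have l0 : @leb01 R (~` `[0, 1[%classic) = 0%E by rewrite /leb01 setICl measure0.
      by rewrite product_measure1E//; rewrite [X in (X * _)%E]l0 mul0e.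
    + by move=> x /= h; apply: contra_not h; rewrite in_itv.
  have ae_tail : {ae distribution (@leb01 R \x P)%E (@tuple_cons n),
      forall x : n.+1.-tuple R, forall i, 0 <= tnth [tuple of behead x] i < 1}.
    have [A [mA A0 cubeA]] := Pcube.
    exists ((fun x : n.+1.-tuple R => [tuple of behead x]) @^-1` A); split.
    + by rewrite -[X in measurable X]setTI; exact: measurable_behead.
    + rewrite /distribution /pushforward /=.
      rewrite (_ : _ @^-1` _ = setT `*` A); last first.
        apply/seteqP; split=> [[x y]|[x y] [_]];
          by rewrite /= (_ : [tuple of _] = y)//; exact: val_inj.
      by rewrite product_measure1E//; rewrite [X in (_ * X)%E]A0 mule0.
    + by move=> x /= h; apply: cubeA.
  apply: filterS2 ae_head ae_tail => x h t i.
  case: (unliftP ord0 i) => [k ->|-> //].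
  have := t k; rewrite !(tnth_nth 0) /= nth_behead; exact.
move=> xi xi0.
pose eta : 'rV[int]_n := \row_j xi ord0 (lift ord0 j).
pose m := xi ord0 ord0.
have charS x (y : n.-tuple R) : char xi (tuple_cons (x, y)) =
    expi (- (2 * pi * (m%:~R * x))) * char eta y.
  rewrite /char -expiD -opprD -mulrDr; congr (expi (- (_ * _))).
  rewrite /dotZR big_ord_recl tnth0; congr (_ + _).
  by apply: eq_bigr => j _; rewrite mxE tnthS.
have [bre bim] := cmeas_char R xi.
have inner x : Complex (\int[P]_y Re (char xi (tuple_cons (x, y))))
    (\int[P]_y Im (char xi (tuple_cons (x, y)))) =
    expi (- (2 * pi * (m%:~R * x))) * cintegral P setT (char eta).
  rewrite -cintZ; last exact: cmeas_char.
  rewrite cintegralE.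
  by congr Complex; apply: eq_Rintegral => y _; rewrite charS.
rewrite cintegralE !Rintegral_torusS//.
(* If the tail frequency [eta] is nonzero the inner integral vanishes; otherwise the head frequency
   [m] is nonzero and the integral in the first coordinate vanishes. *)
have [eta0|eta0] := eqVneq eta 0; last first.
  rewrite (_ : (fun x => \int[P]_y Re _) = cst 0); last first.
    by apply/funext => x; have := inner x; rewrite Pchar// mulr0 => -[].
  rewrite (_ : (fun x => \int[P]_y Im _) = cst 0); last first.
    by apply/funext => x; have := inner x; rewrite Pchar// mulr0 => -[].
  by rewrite !Rint_cst.
have m0 : m != 0.
  apply: contra xi0 => /eqP m0; apply/eqP/rowP => j; rewrite mxE.
  case: (unliftP ord0 j) => [k ->|-> //].
  by move/rowP : eta0 => /(_ k); rewrite !mxE.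
have J1 : cintegral P setT (char eta) = 1.
  rewrite eta0 -[RHS](cint_cst P); congr cintegral.
  by apply/funext => x; rewrite char0.
have [int_cos int_sin] := Rintegral_leb01_trig m0.
rewrite (_ : (fun x => \int[P]_y Re _) = (fun x => cos (- (2 * pi * (m%:~R * x))))).
  rewrite int_cos (_ : (fun x => \int[P]_y Im _) =
      (fun x => sin (- (2 * pi * (m%:~R * x))))).
    by rewrite int_sin.
  by apply/funext => x; have := inner x; rewrite J1 mulr1 => -[].
by apply/funext => x; have := inner x; rewrite J1 mulr1 => -[].
Qed.

End TorusMeasure.

(** * Passage from an almost everywhere bound on [f] to a bound everywhere *)

Theorem theorem1 (R : realType) (d : nat) (f : d.-tuple R -> R[i])
  (S : set 'rV[int]_d) (nu : 'rV[int]_d) :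
  (0 < d)%N ->
  measurable_fun setT (fun x => complex.Re (f x)) ->
  measurable_fun setT (fun x => complex.Im (f x)) ->
  {ae (@torus_measure R d), forall x, ComplexField.Normc.normc (f x) <= 1} ->
  is_halfspace S ->
  (forall xi, S xi -> fourier f xi = 0) ->
  S (- nu) ->
  fourier f 0 != 0 ->
  forall (M p : nat) (k : int), (1 <= M)%N -> (1 <= p)%N ->
  let E := [set x | ComplexField.Normc.normc (f x) = 1] in
  let b (n : nat) (j : int) :=
    cintegral (@torus_measure R d) E (fun x => f x ^+ n * char (nu *~ j) x) in
  let C := ln (16 / ComplexField.Normc.normc (fourier f 0) ^+ 4) in
  (p.+1%:R)^-1 * (\sum_(M <= m < M + p.+1) ComplexField.Normc.normc (b m (m%:Z - k)) ^+ 2)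
    <= C / ln (p.+1%:R).
Proof.
move=> _ mRf mIf f1 halfS f0 Snu ff0 M p k _ p1; cbv zeta.
have [P [PE cubeP int_char]] := torus_probability R d.
rewrite /fourier PE in f1 f0 ff0 *.
pose A := [set x | normc (f x) <= 1].
have mA : measurable A.
  rewrite (_ : A = [set x | sqnormc (f x) <= 1]).
    apply: measurable_ler; last exact: measurable_cst.
    by apply: measurable_funD; exact: measurable_funX.
  apply/seteqP; split=> x; rewrite /A /= -normcEsqr.
    by move=> h; rewrite exprn_ile1 ?normc_ge0.
  by rewrite -[X in _ <= X](expr1n _ 2) ler_sqr ?nnegrE ?normc_ge0.
(* Setting [f] to zero where its modulus exceeds 1 alters it on a null set only, and leaves the set
   of modulus 1 unchanged. *)
pose g x := Complex (\1_A x) 0 * f x.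
have gA x : A x -> g x = f x.
  by move=> Ax; rewrite /g indicE mem_set//; apply: complex_ext; rewrite !ReImE /=; ring.
have gNA x : ~ A x -> g x = 0.
  by move=> Ax; rewrite /g indicE memNset//; apply: complex_ext; rewrite !ReImE /=; ring.
have g1 x : normc (g x) <= 1.
  have [Ax|Ax] := pselect (A x); first by rewrite gA.
  by rewrite gNA// ComplexField.Normc.normc0.
have mIA : measurable_fun setT (\1_A : _ -> R) by exact: measurable_indic.
have cg : cmeas g.
  split; split; try by exists 1 => x; apply: le_trans (g1 x);
    [exact: normr_Re_le || exact: normr_Im_le].
  - rewrite (_ : (fun _ => _) = fun x => \1_A x * Re (f x)); first exact: measurable_funM.
    by apply/funext => x; rewrite /g !ReImE /=; ring.
  - rewrite (_ : (fun _ => _) = fun x => \1_A x * Im (f x)); first exact: measurable_funM.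
    by apply/funext => x; rewrite /g !ReImE /=; ring.
have fg : {ae P, forall x, f x = g x} by apply: filterS f1 => x /gA ->.
have fourierE xi : cintegral P setT (fun x => f x * char xi x) =
    cintegral P setT (fun x => g x * char xi x).
  have [[mRx _] [mIx _]] := cmeas_char R xi.
  have [[mRgx _] [mIgx _]] := cmeasM cg (cmeas_char R xi).
  apply: ae_eq_cint => //.
  - under eq_fun do rewrite RecM.
    by apply: measurable_funB; exact: measurable_funM.
  - under eq_fun do rewrite ImcM.
    by apply: measurable_funD; exact: measurable_funM.
  by apply: filterS fg => x ->.
have f0E : cintegral P setT (fun x => f x * char 0 x) = cintegral P setT g.
  by rewrite fourierE; congr cintegral; apply/funext => x; rewrite char0 mulr1.
rewrite f0E in ff0 *.
(* The frequency (m - k) nu splits: m nu joins the power of [f], and - k nu gives this factor,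
   independent of [m]. *)
pose e := fun x : d.-tuple R => char (nu *~ (- k)) x.
have bE m : cintegral P [set x | normc (f x) = 1]
      (fun x => f x ^+ m * char (nu *~ (m%:Z - k)) x) =
    cintegral P setT (fun x => Complex (\1_[set x | normc (g x) = 1] x) 0 *
      ((g x * char nu x) ^+ m * e x)).
  have pointwise x : Complex (\1_[set x | normc (g x) = 1] x) 0 *
      ((g x * char nu x) ^+ m * e x) =
    if x \in [set x | normc (f x) = 1] then f x ^+ m * char (nu *~ (m%:Z - k)) x else 0.
    case: ifPn => [/set_mem /= fx1|/negP nfx1].
      have Ax : A x by rewrite /A /= fx1.
      rewrite indicE mem_set /= ?gA// /e mulrzBr -pmulrn charD charX mulrNz exprMn.
      by rewrite -[Complex 1 0]/(1 : R[i]) mul1r mulrA.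
    rewrite indicE memNset; first by apply: complex_ext; rewrite !ReImE /=; ring.
    move=> /= gx1; apply: nfx1; apply/mem_set => /=.
    have [Ax|Ax] := pselect (A x); first by rewrite -gA.
    by move: gx1; rewrite gNA// ComplexField.Normc.normc0 => /esym/eqP; rewrite oner_eq0.
  rewrite /cintegral; congr Complex; congr fine; rewrite integral_mkcond;
    apply: eq_integral => x _; rewrite pointwise patchE; by case: ifP.
under eq_bigr do rewrite bE.
apply: (mean_square_bound halfS int_char cubeP cg g1) => //.
- exact: cmeas_char.
- by move=> x; exact: normc_char.
- by move=> xi Sxi; rewrite -fourierE f0.
Qed.
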